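(* Let $\mathbb{P}_{\mathbf{\Sigma}}$ be the two-dimensional toric Deligne–Mumford stack associated to a complete stacky fan $\mathbf{\Sigma}=(\Sigma,\{v_i\}_{i=1}^n)$ in $N\cong\mathbb{Z}^2$. Let $D_1$ and $D_2$ be two elements of $\mathrm{Pic}(\mathbb{P}_{\mathbf{\Sigma}})$ (written additively). If $D_1+lD_2$ is $\mathrm{H}$-trivial for all $l\in\mathbb{Z}_{\ge 0}$, then $D_1+lD_2$ is $\mathrm{H}$-trivial for all $l\in\mathbb{Z}$.
   Context: Setting: $N\cong\mathbb{Z}^2$ is a lattice, $N^*=\mathrm{Hom}(N,\mathbb{Z})$, and $\Sigma$ is a complete simplicial fan in $N$ with $n$ one-dimensional cones. A stacky fan $\mathbf{\Sigma}=(\Sigma,\{v_i\}_{i=1}^n)$ consists of $\Sigma$ together with a choice of a nonzero lattice point $v_i\in N$ (not necessarily primitive) in each one-dimensional cone of $\Sigma$. The stack: let $G=\{(\zeta_1,\dots,\zeta_n)\in(\mathbb{C}^* )^n \mid \prod_{i=1}^n\zeta_i^{w\cdot v_i}=1\text{ for all } w\in N^*\}$, and let $U\subset\mathbb{C}^n$ be the open set of points $(x_1,\dots,x_n)$ such that some cone of $\Sigma$ contains all $v_i$ with $x_i=0$. $G$ acts on $U$ coordinatewise, and $\mathbb{P}_{\mathbf{\Sigma}}=[U/G]$. Line bundles: for $(r_1,\dots,r_n)\in\mathbb{Z}^n$, $\mathcal{O}(\sum_i r_iE_i)$ is the line bundle on $\mathbb{P}_{\mathbf{\Sigma}}$ given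 by the trivial line bundle $\mathbb{C}\times U\to U$ with $G$-linearization $((\zeta_i),t,(x_i))\mapsto(t\prod_i\zeta_i^{r_i},(\zeta_ix_i))$. All line bundles arise this way, and $\mathrm{Pic}(\mathbb{P}_{\mathbf{\Sigma}})$ is the quotient of $\mathbb{Z}^n$ (basis $E_1,\dots,E_n$) by the subgroup of elements $\sum_i (w\cdot v_i)E_i$, $w\in N^*$. A line bundle $\mathcal{L}$ is called $\mathrm{H}$-trivial if $\mathrm{H}^j(\mathbb{P}_{\mathbf{\Sigma}},\mathcal{L})=0$ for all $j\ge 0$. *)

(* Defs.v *)
From HB Require Import structures.
From mathcomp Require Import all_boot all_order all_algebra.
From mathcomp Require Import generic_quotient ring_quotient.
From mathcomp Require Import complex mpoly.
From mathcomp Require Import boolp classical_sets cardinality reals.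
Set Implicit Arguments. Unset Strict Implicit. Unset Printing Implicit Defensive.
Import Order.TTheory GRing.Theory Num.Theory.
Local Open Scope quotient_scope.
Local Open Scope classical_set_scope.
Local Open Scope ring_scope.

(* N = Z^2 is the type of integer row vectors, N^* = Hom(N, Z) the type of
   integer column vectors. *)
Notation lattice := 'rV[int]_2.
Notation dual_lattice := 'cV[int]_2.

Definition pairing (w : dual_lattice) (u : lattice) : int := (u *m w) 0 0.

Section Fans.
Variable R : realType.

Definition real_point (u : lattice) : 'rV[R]_2 := map_mx intr u.

(* The cone in N_R = R^2 generated by the rows of the integer matrix A. *)
Definition cone_span d (A : 'M[int]_(d, 2)) : set 'rV[R]_2 :=
  [set x | exists c : 'rV[R]_d, (forall k, 0 <= c 0 k) /\ x = c *m map_mx intr A].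

Definition rational_polyhedral (sigma : set 'rV[R]_2) : Prop :=
  exists d (A : 'M[int]_(d, 2)), sigma = cone_span A.

Definition strongly_convex (sigma : set 'rV[R]_2) : Prop :=
  forall x, sigma x -> sigma (- x) -> x = 0.

Definition is_face (tau sigma : set 'rV[R]_2) : Prop :=
  exists u : 'cV[R]_2, (forall x, sigma x -> 0 <= (x *m u) 0 0) /\
    tau = [set x | sigma x /\ (x *m u) 0 0 = 0].

Record is_fan (Sigma : set (set 'rV[R]_2)) : Prop := IsFan {
  fan_finite : finite_set Sigma;
  fan_cone : forall sigma, Sigma sigma ->
    rational_polyhedral sigma /\ strongly_convex sigma;
  fan_face : forall sigma tau, Sigma sigma -> is_face tau sigma -> Sigma tau;
  fan_meet : forall sigma tau, Sigma sigma -> Sigma tau ->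
    is_face (sigma `&` tau) sigma /\ is_face (sigma `&` tau) tau }.

(* A cone generated by d linearly independent lattice vectors. *)
Definition simplicial_cone d (sigma : set 'rV[R]_2) : Prop :=
  exists A : 'M[int]_(d, 2),
    row_free (map_mx intr A : 'M[R]_(d, 2)) /\ sigma = cone_span A.

Definition simplicial_fan (Sigma : set (set 'rV[R]_2)) : Prop :=
  forall sigma, Sigma sigma -> exists d, simplicial_cone d sigma.

Definition complete_fan (Sigma : set (set 'rV[R]_2)) : Prop :=
  forall x, exists2 sigma, Sigma sigma & sigma x.

(* The last two fields make i |-> (the ray through v i) a bijection from 'I_n
   to the one-dimensional cones of Sigma, so n is the number of these. *)
Record complete_stacky_fan n (Sigma : set (set 'rV[R]_2))
    (v : 'I_n -> lattice) : Prop := CompleteStackyFan {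
  stacky_fan : is_fan Sigma;
  stacky_simplicial : simplicial_fan Sigma;
  stacky_complete : complete_fan Sigma;
  stacky_neq0 : forall i, v i != 0;
  stacky_in_ray : forall i, exists rho,
    [/\ Sigma rho, simplicial_cone 1 rho & rho (real_point (v i))];
  stacky_ray : forall rho, Sigma rho -> simplicial_cone 1 rho ->
    exists! i, rho (real_point (v i)) }.

End Fans.

Section Picard.
Variables (n : nat) (v : 'I_n -> lattice).

(* The row vector r : 'rV[int]_n stands for \sum_i r_i E_i. *)
Definition char_divisor (w : dual_lattice) : 'rV[int]_n :=
  \row_i pairing w (v i).

Definition trivial_divisor : {pred 'rV[int]_n} :=
  [pred r | `[< exists w, r = char_divisor w >]].

Lemma trivial_divisor_zmod_closed : zmod_closed trivial_divisor.
Proof.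
split=> [|r s].
  apply/asboolP; exists 0; apply/rowP=> i.
  by rewrite !mxE /pairing mulmx0 mxE.
move=> /asboolP[w ->] /asboolP[w' ->]; apply/asboolP; exists (w - w').
by apply/rowP=> i; rewrite !mxE /pairing mulmxBr !mxE.
Qed.

HB.instance Definition _ :=
  GRing.isZmodClosed.Build _ trivial_divisor trivial_divisor_zmod_closed.

Definition Pic : zmodType := Quotient.quot trivial_divisor.

Definition Pic_class (r : 'rV[int]_n) : Pic :=
  \pi_(Quotient.quot trivial_divisor) r.

Definition Pic_repr (D : Pic) : 'rV[int]_n :=
  repr (D : Quotient.quot trivial_divisor).

End Picard.

Section Cohomology.
Variables (R : realType) (n : nat).
Variables (Sigma : set (set 'rV[R]_2)) (v : 'I_n -> lattice).

Local Notation C := (R[i]).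
Local Notation point := ('I_n -> C).

Definition in_G (zeta : point) : Prop :=
  (forall i, zeta i != 0) /\
  forall w : dual_lattice, \prod_i zeta i ^ pairing w (v i) = 1.

(* U is the union of the charts U_sigma for sigma in Sigma, and
   U_sigma `&` U_tau = U_(sigma `&` tau). *)
Definition chart (sigma : set 'rV[R]_2) : set point :=
  [set x | forall i, x i = 0 -> sigma (real_point R (v i))].

(* U_sigma is the principal open subset of C^n where the product of the x_i
   with v_i outside sigma does not vanish; its coordinate ring is the
   localization of C[x_1, ..., x_n] at this product.  Values of f outside
   U_sigma are irrelevant. *)
Definition regular_on_chart (sigma : set 'rV[R]_2) (f : point -> C) : Prop :=
  exists (p : {mpoly C[n]}) (k : nat), forall x, chart sigma x ->
    f x = p.@[x] / (\prod_(i | real_point R (v i) \notin sigma) x i) ^+ k.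

(* x |-> (f x, x) is a G-equivariant section over U_sigma of the trivial line
   bundle with the linearization of O(\sum_i r_i E_i), i.e. a section of that
   line bundle over the open substack [U_sigma / G]. *)
Definition line_bundle_section (r : 'rV[int]_n) (sigma : set 'rV[R]_2)
    (f : point -> C) : Prop :=
  regular_on_chart sigma f /\
  forall zeta x, in_G zeta -> chart sigma x ->
    f (fun i => zeta i * x i) = f x * \prod_i zeta i ^ r 0 i.

(* H^j is the cohomology of the Cech complex of the covering of [U / G] by the
   open substacks [U_sigma / G], sigma in Sigma.  These and their finite
   intersections are quotients of affine varieties by the diagonalizable, hence
   linearly reductive, group G, so line bundles on them have no higher
   cohomology.  A p-cochain assigns to every (p+1)-tuple s of cones of Sigma a
   section over the intersection of the charts of s. *)
Definition cochain (p : nat) : Type :=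
  ('I_p.+1 -> set 'rV[R]_2) -> point -> C.

Definition cones_of p (s : 'I_p.+1 -> set 'rV[R]_2) : Prop :=
  forall k, Sigma (s k).

Definition meet_of p (s : 'I_p.+1 -> set 'rV[R]_2) : set 'rV[R]_2 :=
  [set y | forall k, s k y].

Definition is_cochain (r : 'rV[int]_n) p (c : cochain p) : Prop :=
  forall s, cones_of s -> line_bundle_section r (meet_of s) (c s).

Definition eq_cochain p (c c' : cochain p) : Prop :=
  forall s, cones_of s -> forall x, chart (meet_of s) x -> c s x = c' s x.

Definition cech_d p (c : cochain p) : cochain p.+1 :=
  fun s x => \sum_(k < p.+2) (-1) ^+ k * c (fun m => s (lift k m)) x.

Definition is_cocycle (r : 'rV[int]_n) p (c : cochain p) : Prop :=
  is_cochain r c /\ eq_cochain (cech_d c) (fun _ _ => 0).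

Definition is_coboundary (r : 'rV[int]_n) p : cochain p -> Prop :=
  match p with
  | 0 => fun c => eq_cochain c (fun _ _ => 0)
  | q.+1 => fun c => exists b : cochain q, is_cochain r b /\ eq_cochain c (cech_d b)
  end.

Definition cohomology_vanishes (r : 'rV[int]_n) (j : nat) : Prop :=
  forall c : cochain j, is_cocycle r c -> is_coboundary r c.

Definition H_trivial_bundle (r : 'rV[int]_n) : Prop :=
  forall j, cohomology_vanishes r j.

Definition H_trivial (D : Pic v) : Prop := H_trivial_bundle (Pic_repr D).

(* The linearization of O(\sum_i r_i E_i) only depends on the class of r, so
   the choice of representative in H_trivial is immaterial. *)
Lemma line_bundle_section_class r r' sigma f : Pic_class v r = Pic_class v r' ->
  line_bundle_section r sigma f <-> line_bundle_section r' sigma f.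
Proof.
wlog suff: r r' / Pic_class v r = Pic_class v r' ->
    line_bundle_section r sigma f -> line_bundle_section r' sigma f.
  by move=> H e; split; apply: H.
move=> /eqP; rewrite /Pic_class -Quotient.idealrBE.
move=> /asboolP[w e] [freg fG]; split=> // zeta x Gz Ux.
rewrite fG //; congr (_ * _).
have -> : r = char_divisor v w + r' by rewrite -e subrK.
under eq_bigr => i _ do
  rewrite !mxE expfzDr ?(proj1 Gz) //.
by rewrite big_split /= (proj2 Gz) mul1r.
Qed.

Lemma H_trivial_class r : H_trivial (Pic_class v r) <-> H_trivial_bundle r.
Proof.
have cls : Pic_class v (Pic_repr (Pic_class v r)) = Pic_class v r.
  exact: reprK.
wlog suff: / forall r r', Pic_class v r = Pic_class v r' ->
    H_trivial_bundle r -> H_trivial_bundle r'.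
  by move=> H; split; apply: H.
move=> {cls r} r r' e H j c [cc dc].
have ec p (b : cochain p) : is_cochain r b <-> is_cochain r' b.
  by split=> Hb s Ss; apply/(line_bundle_section_class _ _ e); apply: Hb.
have := H j c (conj (proj2 (ec _ _) cc) dc).
case: j c {cc dc} => //= q c [b [bc Hb]]; exists b; split=> //.
exact: (proj1 (ec _ _)).
Qed.

End Cohomology.

(* Main.v *)
(* Grade the sections over the charts by monomials.  For an exponent m in the
   class of r, the degree-m part of the Cech complex of O(r) consists of the
   functions on tuples of cones of Sigma that vanish on the tuples whose members
   share a ray v_i with m_i < 0; its cohomology is the reduced cohomology,
   shifted by one, of the part of the circle of rays spanned by
   J = {i | m_i < 0}.  Hence O(r) is H-trivial iff for every m in its class J is
   a nonempty, proper, cyclically contiguous set of rays.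

   Write Q_i = (v_i, r2_i) in Z^3, where r1, r2 represent D1, D2.  Moving m in
   the class and l >= 0 adds to r1_i the value at Q_i of any functional with
   nonnegative last coordinate, and the hypothesis forbids a functional that is
   positive on all Q_i or has four alternating signs along the cycle.  So either
   all Q_i are coplanar, and D2 is torsion, or Q_b and Q_k are antipodal for some
   b and k and the Q_i lie on two half-planes bounded by their common line.  In
   the second case a functional vanishing on one half-plane has constant sign on
   the other, so the signs of any l on each half-plane can be realised for some
   l >= 0, and contiguity passes to all l. *)
Require Import Defs.
From mathcomp Require Import all_boot all_order all_algebra.
From mathcomp Require Import generic_quotient ring_quotient.
From mathcomp Require Import cyclic separable cyclotomic.
From mathcomp Require Import complex mpoly.
From mathcomp Require Import boolp classical_sets cardinality reals.
From mathcomp Require Import zify ring lra.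
Set Implicit Arguments. Unset Strict Implicit. Unset Printing Implicit Defensive.
Import Order.TTheory GRing.Theory Num.Theory.
Local Open Scope quotient_scope.
Local Open Scope classical_set_scope.
Local Open Scope ring_scope.

(** * Simplicial cochains on tuples *)

Section Cochains.
Variables (F : comNzRingType) (T : Type).

(* The tuples are indexed by 'I_p, so p = 0 is the augmentation: Cech
   p-cochains are functions on 'I_p.+1 -> T. *)
Definition delta p (a : ('I_p -> T) -> F) : ('I_p.+1 -> T) -> F :=
  fun s => \sum_(k < p.+1) (-1) ^+ k * a (fun m => s (lift k m)).

Definition tcons p (z : T) (s : 'I_p -> T) : 'I_p.+1 -> T :=
  fun k => if unlift ord0 k is Some j then s j else z.

Lemma tcons0 p z (s : 'I_p -> T) : tcons z s ord0 = z.
Proof. by rewrite /tcons unlift_none. Qed.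

Lemma tconsS p z (s : 'I_p -> T) k : tcons z s (lift ord0 k) = s k.
Proof. by rewrite /tcons liftK. Qed.

Lemma tcons_pair z y : tcons z (fun _ : 'I_1 => y) ord_max = y.
Proof.
have -> : ord_max = lift ord0 ord0 :> 'I_2 by apply: val_inj.
by rewrite tconsS.
Qed.

Lemma tcons_eta p (s : 'I_p.+1 -> T) :
  s = tcons (s ord0) (fun k => s (lift ord0 k)).
Proof.
apply: funext => k; case: (unliftP ord0 k) => [j|] ->.
  by rewrite tconsS.
by rewrite tcons0.
Qed.

Lemma tcons_lift p z (s : 'I_p.+1 -> T) k :
  (fun m => tcons z s (lift (lift ord0 k) m)) =
  tcons z (fun m => s (lift k m)) :> ('I_p.+1 -> T).
Proof.
apply: funext => m; case: (unliftP ord0 m) => [j|] ->.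
  have -> : lift (lift ord0 k) (lift ord0 j) = lift ord0 (lift k j).
    by apply: val_inj; rewrite /= /bump /= !add1n ltnS addnS.
  by rewrite !tconsS.
have -> : lift (lift ord0 k) ord0 = ord0 by apply: val_inj.
by rewrite !tcons0.
Qed.

(** Prepending [z] is a contracting homotopy: omitting [z] returns [s], and every other face keeps
    [z] in front with its index, hence its sign, shifted by one. *)
Lemma delta_tcons p (a : ('I_p.+1 -> T) -> F) z s :
  delta a (tcons z s) = a s - delta (fun s' => a (tcons z s')) s.
Proof.
rewrite /delta big_ord_recl expr0 mul1r; congr (a _ + _).
  by apply: funext => m; rewrite tconsS.
rewrite -sumrN; apply: eq_bigr => k _.
by rewrite tcons_lift lift0 exprS mulN1r mulNr.
Qed.

Lemma deltaB p (a b : ('I_p -> T) -> F) s :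
  delta (fun s => a s - b s) s = delta a s - delta b s.
Proof. by rewrite /delta -sumrB; apply: eq_bigr => k _; rewrite mulrBr. Qed.

(** Induction on the length: once the first entry is peeled off with [delta_tcons], two copies of
    [delta a] cancel and a shorter double coboundary remains. *)
Lemma delta_delta p (a : ('I_p -> T) -> F) s : delta (delta a) s = 0.
Proof.
elim: p a s => [|p IH] a s.
  rewrite /delta !big_ord_recl !big_ord0 /= !expr0 expr1 !mul1r !addr0.
  by rewrite mulN1r; apply/eqP; rewrite subr_eq0; apply/eqP; congr a; apply: funext => -[].
rewrite (tcons_eta s) delta_tcons.
set z := s ord0; set s' := fun k => _.
have -> : (fun t => delta a (tcons z t)) =
    (fun t => a t - delta (fun t' => a (tcons z t')) t).
  by apply: funext => t; rewrite delta_tcons.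
by rewrite deltaB IH subr0 subrr.
Qed.

End Cochains.

(** * Contiguity on a cycle *)

Section Cycle.
Local Open Scope nat_scope.
Variables (n : nat) (nx : 'I_n -> 'I_n).
Implicit Types (J : pred 'I_n) (i : 'I_n).

(** Disconnectedness of the subgraph of the cycle induced on [J]: a two-colouring that uses both
    colours and never changes between neighbours in [J]. *)
Definition splits J : Prop :=
  exists P : pred 'I_n, [/\ exists2 i, J i & P i, exists2 i, J i & ~~ P i &
    forall i, J i -> J (nx i) -> P i = P (nx i)].

Definition alternates J (i0 : 'I_n) : Prop :=
  let e p := iter p nx i0 in
  exists a b c d, [/\ a < b < c, c < d < n, J (e b) = ~~ J (e a),
    J (e c) = J (e a) & J (e d) = ~~ J (e a)].

Hypothesis nx_inj : injective nx.
Hypothesis nx_conn : forall i j, fconnect nx i j.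

Lemma cycle_order i0 : order nx i0 = n.
Proof.
rewrite /order -[RHS]card_ord; apply: eq_card => j.
by rewrite !inE nx_conn.
Qed.

Lemma cycle_iter_n i0 : iter n nx i0 = i0.
Proof. by have := iter_order nx_inj i0; rewrite cycle_order. Qed.

Lemma cycle_findex_lt i0 j : findex nx i0 j < n.
Proof. by have := findex_max (nx_conn i0 j); rewrite cycle_order. Qed.

Lemma cycle_findexK i0 p : p < n -> findex nx i0 (iter p nx i0) = p.
Proof. by move=> pn; apply: findex_iter; rewrite cycle_order. Qed.

Lemma cycle_iter_ex i0 j : exists2 p, p < n & iter p nx i0 = j.
Proof.
by exists (findex nx i0 j); [exact: cycle_findex_lt | exact: iter_findex].
Qed.

Lemma cycle_iter_inj i0 p q : p < n -> q < n ->
  iter p nx i0 = iter q nx i0 -> p = q.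
Proof.
move=> pn qn epq.
by rewrite -(cycle_findexK i0 qn) -epq cycle_findexK.
Qed.

(** The two alternating positions outside [J] cut the cycle into two arcs that both meet [J]; the
    colouring marks the arc between them. *)
Lemma alternates_splits J i0 : alternates J i0 -> splits J.
Proof.
pose e p := iter p nx i0.
suff gap lo hi c a : lo < c < hi -> hi < n -> a < n -> ~~ (lo <= a <= hi) ->
    ~~ J (e lo) -> ~~ J (e hi) -> J (e c) -> J (e a) -> splits J.
  move=> [a] [b] [c] [d] [abc cdn Jb Jc Jd].
  have [Ja|Ja] := boolP (J (e a)).
    by apply: (gap b d c a); rewrite -/(e _) ?Jb ?Jd ?Jc ?Ja //; lia.
  by apply: (gap a c b d); rewrite -/(e _) ?Jb ?Jd ?Jc ?Ja //; lia.
move=> lch hn an aout Jlo Jhi Jc Ja.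
pose pos j := findex nx i0 j.
have posK p : p < n -> pos (e p) = p.
  exact: cycle_findexK.
have eK j : e (pos j) = j by exact: iter_findex.
exists (fun j => lo < pos j < hi); split.
- by exists (e c) => //; rewrite posK //; lia.
- by exists (e a) => //; rewrite posK //; lia.
move=> i Ji Jni.
have pn : pos i < n by exact: cycle_findex_lt.
have ni : nx i = e (pos i).+1 by rewrite /e iterS -/(e _) eK.
have lo_i : pos i != lo by apply: contra Jlo => /eqP <-; rewrite eK.
have [pn1|pn1] := ltnP (pos i).+1 n.
  have hi_i : (pos i).+1 != hi by apply: contra Jhi => /eqP <-; rewrite -ni.
  by rewrite ni posK //; lia.
(* The last position is followed by position 0; neither lies strictly between [lo] and [hi]. *)
have pE : (pos i).+1 = n by lia.
have -> : pos (nx i) = 0.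
  rewrite ni pE /e cycle_iter_n -[i0]/(e 0) posK //; lia.
lia.
Qed.

(** Two members of [J] of different colours are separated, on both arcs between them, by a position
    outside [J]. *)
Lemma splits_alternates J i0 : splits J -> alternates J i0.
Proof.
move=> [P [[i Ji Pi] [j Jj Pj] PJ]].
pose e p := iter p nx i0.
have chain p q : p <= q -> (forall m, p <= m <= q -> J (e m)) -> P (e p) = P (e q).
  move=> pq; rewrite -(subnKC pq); elim: (q - p) => [|k IH] Jm; first by rewrite addn0.
  rewrite IH; last by move=> m pm; apply: Jm; lia.
  rewrite addnS /e iterS; apply: PJ; first by apply: (Jm (p + k)); lia.
  by apply: (Jm (p + k).+1); lia.
have gap p q : p <= q -> P (e p) != P (e q) -> exists2 m, p <= m <= q & ~~ J (e m).
  move=> pq Ppq; apply: contrapT => noJ; move/negP: Ppq; apply; apply/eqP.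
  apply: chain => // m pm; apply: contrapT => /negP Jm; apply: noJ; by exists m.
have [p pn ep] := cycle_iter_ex i0 i; have [q qn eq] := cycle_iter_ex i0 j.
suff main p' q' : p' < q' -> q' < n -> J (e p') -> J (e q') ->
    P (e p') != P (e q') -> alternates J i0.
  have [lt_pq|lt_qp|epq] := ltngtP p q.
  - by apply: (main p q); rewrite /e ?ep ?eq // Pi (negbTE Pj).
  - by apply: (main q p); rewrite /e ?ep ?eq // Pi (negbTE Pj).
  - by move: Pj; rewrite -eq -epq ep Pi.
move=> {p q pn qn ep eq i j Ji Pi Jj Pj} lt_pq qn Jp Jq Ppq.
have [b pbq Jb] := gap _ _ (ltnW lt_pq) Ppq.
have bp : b != p' by apply: contraNneq Jb => ->.
have bq : b != q' by apply: contraNneq Jb => ->.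
have e0 : e (n + p') = e p' by rewrite /e addnC iterD cycle_iter_n.
(* The second arc runs from [q'] past [n] round to [p']; a gap found beyond [n] is moved back by [n]
   and then precedes [p']. *)
have [||d qdp Jd] := gap q' (n + p'); first by lia.
  by rewrite e0 eq_sym.
have dq : d != q' by apply: contraNneq Jd => ->.
have dp : d != n + p' by apply: contraNneq Jd => ->; rewrite e0.
have [dn|dn] := ltnP d n.
  exists p', b, q', d; split; rewrite -/(e _) ?Jp ?Jq ?(negbTE Jb) ?(negbTE Jd) //; lia.
have ed : e (d - n) = e d.
  by rewrite -{2}(subnK dn) /e iterD cycle_iter_n.
exists (d - n), p', b, q'.
split; rewrite -?/(e (d - n)) -?/(e p') -?/(e b) -?/(e q')
  ?ed ?Jp ?Jq ?(negbTE Jb) ?(negbTE Jd) //; lia.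
Qed.

End Cycle.

(** * Exactness of the relative complex *)

Section Exactness.
Variables (F : comNzRingType) (T : Type) (S : T -> Prop).
Variables (n : nat) (inc : T -> 'I_n -> Prop).
Implicit Types (J : pred 'I_n).

Definition all_in p (s : 'I_p -> T) : Prop := forall k, S (s k).

Definition share J p (s : 'I_p -> T) : Prop :=
  exists2 i, J i & forall k, inc (s k) i.

Definition relative J p (a : ('I_p -> T) -> F) : Prop :=
  forall s, all_in s -> share J s -> a s = 0.

(* For J nonempty the empty tuple satisfies [share J], so exactness at p = 0
   says that degree-0 Cech cocycles vanish. *)
Definition relative_exact J : Prop := forall p (a : ('I_p.+1 -> T) -> F),
  relative J a -> (forall s, all_in s -> delta a s = 0) ->
  exists b : ('I_p -> T) -> F,
    relative J b /\ forall s, all_in s -> a s = delta b s.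

Lemma all_in_tcons p z (s : 'I_p -> T) : S z -> all_in s -> all_in (tcons z s).
Proof. by move=> Sz Ss k; rewrite /tcons; case: unliftP => [j|] _. Qed.

Lemma inc_tcons p z (s : 'I_p -> T) i :
  inc z i -> (forall k, inc (s k) i) -> forall k, inc (tcons z s k) i.
Proof. by move=> zi si k; rewrite /tcons; case: unliftP => [j|] _. Qed.

Lemma delta_ext p (a b : ('I_p -> T) -> F) (s : 'I_p.+1 -> T) :
  (forall k : 'I_p.+1, a (fun m => s (lift k m)) = b (fun m => s (lift k m))) ->
  delta a s = delta b s.
Proof. by move=> ab; apply: eq_bigr => k _; rewrite ab. Qed.

Lemma cone_contract p (a : ('I_p.+1 -> T) -> F) z s :
  delta a (tcons z s) = 0 -> a s = delta (fun s' => a (tcons z s')) s.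
Proof. by rewrite delta_tcons => /eqP; rewrite subr_eq0 => /eqP. Qed.

(** Prepending a cone [z] through the ray [i] preserves the property of sharing [i], so the
    contraction respects the relative complex. *)
Lemma relative_exact1 i z : S z -> inc z i -> relative_exact (pred1 i).
Proof.
move=> Sz zi p a ra da; exists (fun s => a (tcons z s)); split.
  move=> s Ss [j /eqP -> sj]; apply: ra; first exact: all_in_tcons.
  by exists i; rewrite /= ?eqxx //; apply: inc_tcons.
by move=> s Ss; apply: cone_contract; apply: da; apply: all_in_tcons.
Qed.

(* A primitive b of a cocycle relative to J is a cocycle on the star of y, which
   is contractible with apex z; subtracting the corresponding coboundary makes
   b vanish there. *)
Lemma relative_exactU J y y' z : S z -> inc z y -> inc z y' -> J y' ->
  (forall x i, S x -> J i -> inc x y -> inc x i -> i = y') ->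
  relative_exact J -> relative_exact (predU1 y J).
Proof.
move=> Sz zy zy' Jy' Jy exJ p a ra da.
have raJ : relative J a.
  by move=> s Ss [i Ji si]; apply: ra => //; exists i => //=; rewrite Ji orbT.
have [b [rb ab]] := exJ p a raJ da.
case: p a ra da raJ b rb ab => [|p] a ra da raJ b rb ab.
  (* Only the empty tuple is left; it shares [y'] vacuously, so [b] vanishes there. *)
  exists b; split=> // s Ss _; apply: rb => //.
  by exists y' => // -[].
pose g (s : 'I_p -> T) :=
  if `[< forall k, inc (s k) y >] then b (tcons z s) else 0.
have g_rel s : all_in s -> share J s -> g s = 0.
  move=> Ss [i Ji si]; rewrite /g; case: asboolP => // sy.
  apply: rb; first exact: all_in_tcons.
  exists y' => //; apply: inc_tcons => // k.
  by rewrite -(Jy _ _ (Ss k) Ji (sy k) (si k)).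
exists (fun s => b s - delta g s); split; last first.
  by move=> s Ss; rewrite deltaB delta_delta subr0 ab.
move=> s Ss [i /predU1P[->|Ji] si].
  have -> : delta g s = delta (fun s' => b (tcons z s')) s.
    by apply: delta_ext => k; rewrite /g; case: asboolP.
  rewrite -cone_contract ?subrr // -ab; last exact: all_in_tcons.
  apply: ra; first exact: all_in_tcons.
  by exists y; rewrite /= ?eqxx //; apply: inc_tcons.
rewrite rb //; last by exists i.
rewrite /delta big1 ?subr0 // => k _; rewrite g_rel ?mulr0 //.
by exists i.
Qed.

Variable nx : 'I_n -> 'I_n.
Hypothesis inc_next : forall i,
  exists2 x, S x & forall k, inc x k <-> k = i \/ k = nx i.
Hypothesis inc_le2 : forall x j, S x -> inc x j ->
  exists i, forall k, inc x k -> k = i \/ k = nx i.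

(** The colouring induces a function [g] on cones that agrees on cones sharing a ray of [J], so
    [delta g] is a relative cocycle. A relative primitive vanishes on every cone meeting [J], which
    would force [g] to agree on cones of different colours. *)
Lemma relative_exact_nsplits J : relative_exact J -> ~ splits nx J.
Proof.
move=> exJ [P [[i Ji Pi] [j Jj Pj] PJ]].
have Pcst x k k' : S x -> J k -> J k' -> inc x k -> inc x k' -> P k = P k'.
  move=> Sx Jk Jk' xk xk'; have [m incm] := inc_le2 Sx xk.
  case: (incm _ xk) (incm _ xk') Jk Jk' => -> [] -> Jk Jk' //; first exact: PJ.
  by rewrite -PJ.
pose g (s : 'I_1 -> T) : F :=
  (`[< exists k, [/\ J k, P k & inc (s ord0) k] >])%:R.
have gP s k : all_in s -> J k -> inc (s ord0) k -> g s = (P k)%:R.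
  move=> Ss Jk sk; rewrite /g; congr (nat_of_bool _)%:R.
  apply/asboolP/idP => [[k' [Jk' Pk' sk']]|Pk]; last by exists k.
  by rewrite (Pcst _ _ _ (Ss ord0) Jk Jk' sk sk').
have [||b [rb gb]] := exJ 1%N (delta g).
- move=> s Ss [k Jk sk]; rewrite /delta !big_ord_recl big_ord0 /= expr0 expr1.
  by rewrite !(gP _ k) //= ?mul1r ?mulN1r ?addr0 ?subrr // => m; apply: Ss.
- by move=> s _; apply: delta_delta.
have [x Sx xinc] := inc_next i; have [y Sy yinc] := inc_next j.
have xi : inc x i by apply/xinc; left.
have yj : inc y j by apply/yinc; left.
pose s := tcons x (fun _ : 'I_1 => y).
have Ss : all_in s by apply: all_in_tcons.
have s0 : s (lift ord_max ord0) = x.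
  by rewrite -[RHS](tcons0 x (fun _ : 'I_1 => y)); congr (s _); apply: val_inj.
have s1 : s (lift ord0 ord0) = y by rewrite /s tconsS.
have := gb s Ss; rewrite /delta !big_ord_recl !big_ord0 /= expr0 expr1.
have e : lift ord0 ord0 = ord_max :> 'I_2 by apply: val_inj.
rewrite !mul1r !mulN1r !addr0 e (gP _ j) ?(gP _ i) ?s0 ?s1 ?Pi ?(negbTE Pj) //.
have bx : b (fun m => s (lift ord_max m)) = 0.
  by apply: rb => [m|]; [exact: Ss | exists i => // m; rewrite (ord1 m) s0].
have by_ : b (fun m => s (lift ord0 m)) = 0.
  by apply: rb => [m|]; [exact: Ss | exists j => // m; rewrite (ord1 m) s1].
by rewrite bx by_ subrr sub0r => /eqP; rewrite oppr_eq0 oner_eq0.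
Qed.

Hypothesis nx_inj : injective nx.
Hypothesis nx_conn : forall i j, fconnect nx i j.

(** The arc grows one ray at a time by [relative_exactU]. Position 0 stays outside, so a new ray
    touches the old arc on one side only. *)
Lemma relative_exact_arc i0 x y : (0 < x <= y)%N -> (y < n)%N ->
  relative_exact (fun i => x <= findex nx i0 i <= y)%N.
Proof.
move=> xy; have [k ->] : exists k, y = (x + k)%N by exists (y - x)%N; lia.
have {xy} x0 : (0 < x)%N by lia.
elim: k => [|k IH] yn.
  have -> : (fun i => x <= findex nx i0 i <= x + 0)%N = pred1 (iter x nx i0).
    apply: funext => i /=; rewrite addn0 -eqn_leq.
    apply/eqP/eqP => [->|->]; first by rewrite iter_findex.
    by rewrite cycle_findexK //; lia.
  have [z Sz zinc] := inc_next (iter x nx i0).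
  by apply: (relative_exact1 Sz); apply/zinc; left.
set y' := (x + k)%N in IH.
have xy' : (x <= y')%N by rewrite leq_addr.
have y'n : (y'.+1 < n)%N by rewrite /y' -addnS.
have -> : (fun i => x <= findex nx i0 i <= x + k.+1)%N =
    predU1 (iter y'.+1 nx i0) (fun i => x <= findex nx i0 i <= y')%N.
  apply: funext => i /=; have [->|ne] := eqVneq i (iter y'.+1 nx i0).
    rewrite cycle_findexK // orTb /y'; lia.
  have : findex nx i0 i != y'.+1.
    by apply: contraNneq ne => <-; rewrite iter_findex.
  by rewrite /y' /=; lia.
have [z Sz zinc] := inc_next (iter y' nx i0).
apply: (relative_exactU Sz (y' := iter y' nx i0)).
- by apply/zinc; right; rewrite iterS.
- by apply/zinc; left.
- by rewrite cycle_findexK //; lia.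
(* A cone through the new ray at [y'.+1] has its other ray at [y'] or at [y'.+2]; the latter, which
   wraps to 0 at the end of the cycle, is outside the arc. *)
- move=> t i St it ty ti; have [m tm] := inc_le2 St ty.
  case: (tm _ ty) => [em|/nx_inj em].
    case: (tm _ ti) => ei; first by move: it; rewrite ei -em cycle_findexK //; lia.
    move: it; rewrite ei -em -iterS.
    have [yn2|yn2] := ltnP y'.+2 n; first by rewrite cycle_findexK //; lia.
    have -> : y'.+2 = n by lia.
    by rewrite cycle_iter_n // -[X in findex _ _ X]/(iter 0 nx i0) cycle_findexK //; lia.
  case: (tm _ ti) => ei; first by rewrite ei -em.
  by move: it; rewrite ei -em -iterS cycle_findexK //; lia.
- exact: IH (ltnW y'n).
Qed.

(** Measured from a ray [i0] outside [J], the set [J] is the interval from its first to its last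
    position: a missing position in between would alternate together with [i0]. *)
Lemma relative_exact_nsplit J : (exists i, J i) -> (exists i, ~~ J i) ->
  ~ splits nx J -> relative_exact J.
Proof.
move=> [j Jj] [i0 Ji0] nJ.
pose pos i := findex nx i0 i; pose e p := iter p nx i0.
have posn i : (pos i < n)%N by exact: cycle_findex_lt.
have eK i : e (pos i) = i by exact: iter_findex.
have exJ : exists p, (p < n)%N && J (e p) by exists (pos j); rewrite posn eK.
have Jn p : (p < n)%N && J (e p) -> (p <= n)%N by move=> /andP[/ltnW].
case: (ex_minnP exJ) => x /andP[xn Jx] xmin.
case: (ex_maxnP exJ Jn) => y /andP[yn Jy] ymax.
suff -> : J = (fun i => x <= pos i <= y)%N.
  apply: relative_exact_arc => //.
  rewrite (xmin y) ?yn // andbT lt0n; apply: contraNneq Ji0 => x0.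
  by move: Jx; rewrite x0.
apply: funext => i; apply/idP/idP => [Ji|xiy].
  by rewrite xmin ?ymax ?posn ?eK.
apply: contrapT => /negP Ji; apply: nJ; apply: (@alternates_splits _ _ nx_inj nx_conn J i0).
have ix : pos i != x by apply: contraNneq Ji => ex; rewrite -(eK i) ex.
have iy : pos i != y by apply: contraNneq Ji => ex; rewrite -(eK i) ex.
have x0 : x != 0%N by apply: contraNneq Ji0 => x0; move: Jx; rewrite x0.
exists 0%N, x, (pos i), y.
split; rewrite /= -?/(e x) -?/(e y) -?/(e (pos i)) ?eK ?Jx ?Jy ?(negbTE Ji) ?(negbTE Ji0) //; lia.
Qed.

(** The relative complex now sees the whole circle. On tuples sharing a ray, [h] is a coboundary, so
    [delta h] is a relative cocycle. A relative primitive [c] would make [h - c] the coboundary of a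
    function [g] whose increments around the cycle of cones sum to 1. *)
Lemma relative_nexactT J : (2 < n)%N -> (forall i, J i) -> ~ relative_exact J.
Proof.
move=> n3 JT exJ; have n0 : (0 < n)%N by lia.
pose e p := iter p nx (Ordinal n0); pose a := e 0%N; pose b := e 1%N.
pose ia x : F := (`[< inc x a >])%:R.
(* The winding class of the cycle of cones, cut between the ray b and the cone
   spanned by a and b. *)
pose h (s : 'I_2 -> T) : F :=
  if `[< forall k, inc (s k) b >] then ia (s ord0) - ia (s ord_max) else 0.
pose G (s : 'I_1 -> T) : F := ia (s ord0).
have deltaG s (g : ('I_1 -> T) -> F) :
    delta g s = g (fun=> s ord_max) - g (fun=> s ord0).
  rewrite /delta !big_ord_recl big_ord0 /= expr0 expr1 mul1r mulN1r addr0.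
  congr (g _ - g _); apply: funext => m; rewrite (ord1 m); congr s; exact: val_inj.
have e_eq p q : (p < n)%N -> (q < n)%N -> e p = e q -> p = q.
  exact: cycle_iter_inj.
have ab : a <> b by move=> /e_eq; lia.
have [||c [rc dhc]] := exJ 2%N (delta h).
- move=> s Ss [i _ si]; have [ib|ib] := eqVneq i b.
    have -> : delta h s = delta (fun s' => 0 - delta G s') s.
      apply: delta_ext => k; rewrite deltaG /G /h asboolT ?sub0r ?opprB //.
      by move=> m; rewrite -ib; apply: si.
    rewrite deltaB delta_delta subr0 /delta big1 // => k _; exact: mulr0.
  rewrite /delta big1 // => k _; rewrite /h; case: asboolP => [sb|]; rewrite ?mulr0 //.
  (* A cone through both [i] and [b] has no third ray, so it contains [a] exactly when [a] is
     [i]. *)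
  suff iaE t : S t -> inc t i -> inc t b -> ia t = (a == i)%:R.
    by rewrite !iaE ?subrr ?mulr0.
  move=> St ti tb; rewrite /ia; congr (nat_of_bool _)%:R.
  apply/asboolP/eqP => [ta|->] //.
  have [m tm] := inc_le2 St tb.
  move/eqP: ib => ib.
  by case: (tm _ ta) (tm _ ti) (tm _ tb) => ea [] ei [] eb; congruence.
- by move=> s _; apply: delta_delta.
have Sx (i : 'I_n) : {x | S x & forall k, inc x k <-> k = i \/ k = nx i}.
  by apply: cid2; apply: inc_next.
pose X p := s2val (Sx (e p)).
have SX p : S (X p) by rewrite /X; case: (Sx _).
have XP p k : inc (X p) k <-> k = e p \/ k = e p.+1.
  by rewrite /X; case: (Sx _) => /= x _.
have Xe p : inc (X p) (e p) by apply/XP; left.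
have XS p : inc (X p) (e p.+1) by apply/XP; right.
pose hc s := h s - c s.
have hcE s : all_in s -> hc s = delta (fun s' => hc (tcons (X 0%N) s')) s.
  move=> Ss; apply: cone_contract; rewrite deltaB dhc ?subrr //.
  exact: all_in_tcons.
pose g x : F := hc (tcons (X 0%N) (fun=> x)).
have gE p q i : inc (X p) i -> inc (X q) i ->
    h (tcons (X p) (fun=> X q)) = g (X q) - g (X p).
  move=> pi qi; set s := tcons _ _.
  have Ss : all_in s by apply: all_in_tcons.
  have c0 : c s = 0.
    by apply: rc => //; exists i => //; apply: inc_tcons.
  rewrite -[LHS]subr0 -c0 -/(hc s) hcE // deltaG /g.
  by rewrite /s tcons_pair tcons0.
have h0 p q : ~ inc (X p) b -> h (tcons (X p) (fun=> X q)) = 0.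
  by move=> pb; rewrite /h; case: asboolP => // /(_ ord0); rewrite tcons0.
have en : e n = e 0%N by exact: cycle_iter_n.
have Xb p : (1 < p < n)%N -> ~ inc (X p) b.
  move=> pn /XP [/e_eq|]; first lia.
  have [pn1|pn1] := ltnP p.+1 n; first by move=> /e_eq; lia.
  have -> : p.+1 = n by lia.
  by rewrite en => /esym.
(* Each of these steps has an end that misses [b], where [h] vanishes; only the step from [X 0] to
   [X 1] crosses the cut. *)
have gX k : (k.+1 < n)%N -> g (X k.+1) = g (X 1%N).
  elim: k => // k IH kn; rewrite -IH; last lia.
  apply/eqP; rewrite eq_sym -subr_eq0; apply/eqP.
  rewrite -(gE k.+2 k.+1 (e k.+2)) //; apply: h0; apply: Xb; lia.
have g10 : g (X 1%N) = g (X 0%N).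
  have nE : n.-2.+2 = n by lia.
  rewrite -(gX n.-2); last lia.
  apply/eqP; rewrite eq_sym -subr_eq0 -(gE _ _ a).
  - by apply/eqP; apply: h0; apply: Xb; lia.
  - by apply/XP; right; rewrite nE en.
  - exact: Xe.
have := gE 0%N 1%N b (XS 0%N) (Xe 1%N).
have a1 : ~ inc (X 1%N) a by move=> /XP [] /e_eq; lia.
rewrite g10 subrr /h asboolT; last exact: inc_tcons (XS 0%N) (fun=> Xe 1%N).
rewrite tcons_pair tcons0 /ia asboolT; last exact: Xe.
by rewrite asboolF // subr0 => /eqP; rewrite oner_eq0.
Qed.

End Exactness.

(** * Cones of a complete stacky fan *)

Definition det2 (K : comNzRingType) (x y : 'rV[K]_2) : K :=
  x 0 0 * y 0 1 - x 0 1 * y 0 0.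

Definition dot2 (K : comNzRingType) (x y : 'rV[K]_2) : K :=
  x 0 0 * y 0 0 + x 0 1 * y 0 1.

Section Cones.
Variable R : realType.
Implicit Types (x y : 'rV[R]_2) (u w : lattice).

Lemma rV2P (K : comNzRingType) (x y : 'rV[K]_2) :
  x 0 0 = y 0 0 -> x 0 1 = y 0 1 -> x = y.
Proof.
move=> e0 e1; apply/rowP=> j.
have [->|->] : j = 0 \/ j = 1; last by []; last by [].
by case: j => [[|[|]]] // h; [left | right]; apply: val_inj.
Qed.

Lemma det2_real u w :
  det2 (real_point R u) (real_point R w) = (det2 u w)%:~R.
Proof. by rewrite /det2 !mxE rmorphB !rmorphM. Qed.

Lemma cone_span1P (A : 'M[int]_(1, 2)) x :
  cone_span A x <-> exists2 c : R, 0 <= c & x = c *: real_point R (row 0 A).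
Proof.
split=> [[c [c0 ->]]|[c c0 ->]].
  exists (c 0 0) => //; apply/rowP => j.
  by rewrite !mxE big_ord_recl big_ord0 addr0 !mxE.
exists (const_mx c); split; first by move=> k; rewrite mxE.
by apply/rowP => j; rewrite !mxE big_ord_recl big_ord0 addr0 !mxE.
Qed.

Lemma cone_span2P (A : 'M[int]_(2, 2)) x :
  cone_span A x <-> exists c d : R, [/\ 0 <= c, 0 <= d &
    x = c *: real_point R (row 0 A) + d *: real_point R (row 1 A)].
Proof.
have e (c : 'rV[R]_2) : c *m map_mx intr A =
    c 0 0 *: real_point R (row 0 A) + c 0 1 *: real_point R (row 1 A).
  apply/rowP => j; rewrite !mxE !big_ord_recl big_ord0 addr0 !mxE.
  by have -> : lift ord0 ord0 = 1 :> 'I_2 by apply: val_inj.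
split=> [[c [c0 ->]]|[c [d [c0 d0 ->]]]].
  by exists (c 0 0), (c 0 1).
exists (\row_k if k == 0 then c else d); split.
  by move=> k; rewrite mxE; case: ifP.
by rewrite e !mxE.
Qed.

Lemma cone_span0P (A : 'M[int]_(0, 2)) x : cone_span A x -> x = 0.
Proof. by move=> [c [_ ->]]; rewrite [c]thinmx0 mul0mx. Qed.

Lemma row_free_det2 (A : 'M[int]_(2, 2)) :
  row_free (map_mx intr A : 'M[R]_(2, 2)) -> det2 (row 0 A) (row 1 A) != 0.
Proof.
rewrite row_free_unit unitmxE unitfE det_map_mx intr_eq0.
rewrite (expand_det_row _ 0) !big_ord_recl big_ord0 addr0 /cofactor !det_mx11 !mxE /=.
rewrite /det2 !mxE.
have -> : lift 0 0 = 1 :> 'I_2 by apply: val_inj.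
have -> : lift 1 0 = 0 :> 'I_2 by apply: val_inj.
by rewrite /bump /= !add0n expr0 expr1 mul1r mulN1r mulrN.
Qed.

Lemma row_free_row2 (u : lattice) : u != 0 ->
  row_free (map_mx intr u : 'M[R]_(1, 2)).
Proof.
move=> u0; rewrite /row_free rank_rV eqb1.
apply: contra u0 => /eqP/rowP e; apply/eqP/rowP => j.
by have := e j; rewrite !mxE => /eqP; rewrite intr_eq0 => /eqP.
Qed.

Variables (n : nat) (Sigma : set (set 'rV[R]_2)) (v : 'I_n -> lattice).
Hypothesis hSigma : complete_stacky_fan Sigma v.

Local Notation vR i := (real_point R (v i)).

Lemma det2ZZ (c d : R) x y : det2 (c *: x) (d *: y) = c * d * det2 x y.
Proof. by rewrite /det2 !mxE; ring. Qed.

Lemma det2C (K : comNzRingType) (x y : 'rV[K]_2) : det2 x y = - det2 y x.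
Proof. by rewrite /det2; ring. Qed.

Lemma det2xx (K : comNzRingType) (x : 'rV[K]_2) : det2 x x = 0.
Proof. by rewrite /det2; ring. Qed.

Lemma det2_eqP x y : det2 x y != 0 -> forall z,
  z = (det2 z y / det2 x y) *: x + (det2 x z / det2 x y) *: y.
Proof. by rewrite /det2 => D z; apply: rV2P; rewrite !mxE; field. Qed.

Lemma stacky_ray_uniq rho i j : Sigma rho -> simplicial_cone 1 rho ->
  rho (vR i) -> rho (vR j) -> i = j.
Proof.
move=> Srho rho1 rho_i rho_j; have [k [_ ku]] := stacky_ray hSigma Srho rho1.
by rewrite -(ku _ rho_i) -(ku _ rho_j).
Qed.

Lemma cone2_face (sigma tau : set 'rV[R]_2) (p q : 'rV[R]_2) : det2 p q != 0 ->
  (forall x, sigma x <-> exists c d : R, [/\ 0 <= c, 0 <= d & x = c *: p + d *: q]) ->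
  (forall x, tau x <-> exists2 c : R, 0 <= c & x = c *: p) ->
  is_face tau sigma.
Proof.
move=> D0 sigmaE tauE.
(* This is the functional [det2 p q * det2 p x] of [x]; the first factor makes it nonnegative at [q]
   for either orientation. *)
pose u : 'cV[R]_2 := \col_i (det2 p q * (if i == 0 then - p 0 1 else p 0 0)).
have uE c d : ((c *: p + d *: q) *m u) 0 0 = d * det2 p q ^+ 2.
  rewrite !mxE !big_ord_recl big_ord0 !mxE /=.
  have -> : lift ord0 ord0 = 1 :> 'I_2 by apply: val_inj.
  rewrite /det2; ring.
exists u; split=> [x /sigmaE[c [d [c0 d0 ->]]]|].
  by rewrite uE mulr_ge0 // sqr_ge0.
apply/seteqP; split=> x /=.
  move=> /tauE[c c0 ->]; split.
    by apply/sigmaE; exists c, 0; split=> //; rewrite scale0r addr0.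
  by rewrite -[c *: p]addr0 -(scale0r q) uE mul0r.
move=> [/sigmaE[c [d [c0 d0 ->]]]]; rewrite uE => /eqP.
rewrite mulf_eq0 sqrf_eq0 (negbTE D0) orbF => /eqP ->.
by apply/tauE; exists c => //; rewrite scale0r addr0.
Qed.

(** The edge spanned by [p] is a face, hence a ray of the fan, and so carries exactly one of the
    chosen vectors. *)
Lemma cone2_ray (sigma : set 'rV[R]_2) (p q : lattice) : det2 p q != 0 ->
  (forall x, sigma x <-> exists c d : R, [/\ 0 <= c, 0 <= d &
     x = c *: real_point R p + d *: real_point R q]) ->
  Sigma sigma ->
  exists k, (exists2 c : R, 0 < c & vR k = c *: real_point R p) /\
    forall i c, 0 <= c -> vR i = c *: real_point R p -> i = k.
Proof.
move=> D0 sigmaE Ssigma.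
have D0' : det2 (real_point R p) (real_point R q) != 0.
  by rewrite det2_real intr_eq0.
have tauE x : cone_span p x <-> exists2 c : R, 0 <= c & x = c *: real_point R p.
  by rewrite cone_span1P row_id.
have Stau : Sigma (cone_span p).
  apply: (fan_face (stacky_fan hSigma) Ssigma).
  exact: cone2_face D0' sigmaE tauE.
have tau1 : simplicial_cone 1 (cone_span p : set 'rV[R]_2).
  exists p; split=> //; apply: row_free_row2.
  by apply: contraNneq D0 => ->; rewrite /det2 !mxE !mul0r subrr.
have [k [/tauE[c c0 ck] ku]] := stacky_ray hSigma Stau tau1.
exists k; split; last first.
  by move=> i c' c'0 ei; apply/esym/ku/tauE; exists c'.
exists c => //; rewrite lt_def c0 andbT; apply: contra (stacky_neq0 hSigma k).
move=> /eqP c00; apply/eqP/rowP => j; have /rowP/(_ j) := ck.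
by rewrite c00 scale0r !mxE => /eqP; rewrite intr_eq0 => /eqP.
Qed.

Lemma cone2_in (sigma : set 'rV[R]_2) (p q : lattice) : det2 p q != 0 ->
  (forall x, sigma x <-> exists c d : R, [/\ 0 <= c, 0 <= d &
     x = c *: real_point R p + d *: real_point R q]) ->
  Sigma sigma -> forall i, sigma (vR i) -> exists2 c : R, 0 <= c &
    vR i = c *: real_point R p \/ vR i = c *: real_point R q.
Proof.
move=> D0 sigmaE Ssigma i /[dup] sigma_i /sigmaE[c [d [c0 d0 vi]]].
have [c00|c00] := eqVneq c 0.
  by exists d => //; right; rewrite vi c00 scale0r add0r.
have [d00|d00] := eqVneq d 0.
  by exists c => //; left; rewrite vi d00 scale0r addr0.
have [rho [Srho rho1 rho_i]] := stacky_in_ray hSigma i.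
(* If v i were interior to sigma, the functional u cutting out the face
   rho `&` sigma would vanish on sigma, so sigma would lie in the ray rho. *)
have [_ [u [u0 uE]]] := fan_meet (stacky_fan hSigma) Srho Ssigma.
have sp : sigma (real_point R p).
  by apply/sigmaE; exists 1, 0; rewrite scale1r scale0r addr0.
have sq : sigma (real_point R q).
  by apply/sigmaE; exists 0, 1; rewrite scale1r scale0r add0r.
have : [set x | sigma x /\ (x *m u) 0 0 = 0] (vR i) by rewrite -uE.
case=> _; rewrite vi mulmxDl -!scalemxAl !mxE -/((_ *m u) 0 0).
set up := \sum_j _; set uq := \sum_j _ => upq.
have up0 : 0 <= up by have := u0 _ sp; rewrite mxE.
have uq0 : 0 <= uq by have := u0 _ sq; rewrite mxE.
have [up00 uq00] : up = 0 /\ uq = 0.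
  have cp : 0 < c by rewrite lt_def c00.
  have dp : 0 < d by rewrite lt_def d00.
  by split; nra.
have rp : rho (real_point R p).
  have : [set x | sigma x /\ (x *m u) 0 0 = 0] (real_point R p).
    by split=> //; rewrite mxE.
  by rewrite -uE; case.
have rq : rho (real_point R q).
  have : [set x | sigma x /\ (x *m u) 0 0 = 0] (real_point R q).
    by split=> //; rewrite mxE.
  by rewrite -uE; case.
have [B [_ rhoE]] := rho1; rewrite rhoE in rp rq.
have [a _ ep] := proj1 (cone_span1P _ _) rp.
have [b _ eq] := proj1 (cone_span1P _ _) rq.
have : det2 (real_point R p) (real_point R q) != 0 by rewrite det2_real intr_eq0.
by rewrite ep eq det2ZZ det2xx mulr0 eqxx.
Qed.

Lemma cone2_cases (sigma : set 'rV[R]_2) (p q : lattice) : 0 < det2 p q ->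
  (forall x, sigma x <-> exists c d : R, [/\ 0 <= c, 0 <= d &
     x = c *: real_point R p + d *: real_point R q]) ->
  Sigma sigma -> exists k l, [/\ 0 < det2 (v k) (v l),
    forall i, sigma (vR i) <-> i = k \/ i = l &
    forall y : lattice, sigma (real_point R y) <-> 0 <= det2 (v k) y /\ 0 <= det2 y (v l)].
Proof.
move=> D0 sigmaE Ssigma.
have D1 : det2 p q != 0 by rewrite gt_eqF.
have D1' : det2 q p != 0 by rewrite det2C oppr_eq0.
have [k [[a a0 ka] ku]] := cone2_ray D1 sigmaE Ssigma.
have sigmaE' x : sigma x <-> exists c d : R, [/\ 0 <= c, 0 <= d &
     x = c *: real_point R q + d *: real_point R p].
  by rewrite sigmaE; split=> -[c [d [c0 d0 ->]]]; exists d, c; rewrite addrC.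
have [l [[b b0 lb] lu]] := cone2_ray D1' sigmaE' Ssigma.
have D0' : 0 < det2 (real_point R p) (real_point R q).
  by rewrite det2_real ltr0z.
exists k, l; split.
- by rewrite -(ltr0z R) -det2_real ka lb det2ZZ !mulr_gt0.
- move=> i; split=> [si|[]->].
  + have [c c0 [e|e]] := cone2_in D1 sigmaE Ssigma si.
      by left; apply: ku c0 e.
    by right; apply: lu c0 e.
  + by apply/sigmaE; exists a, 0; rewrite scale0r addr0; split=> //; exact: ltW.
  + by apply/sigmaE; exists 0, b; rewrite scale0r add0r; split=> //; exact: ltW.
move=> y; rewrite -!(ler0z R) -!det2_real ka lb.
rewrite -[real_point R y]scale1r !det2ZZ mulr1 mul1r !pmulr_rge0 // scale1r.
split=> [/sigmaE[c [d [c0 d0 ->]]]|[ky yl]].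
  by move: D0'; rewrite /det2 !mxE => D0'; split; nra.
apply/sigmaE; do 2!eexists; split; last exact: (det2_eqP (lt0r_neq0 D0')).
  by rewrite divr_ge0 // ltW.
by rewrite divr_ge0 // ltW.
Qed.

(** Classification by dimension. It trades real cones for integer determinants: the edges of a plane
    cone are named counterclockwise by two of the chosen vectors. *)
Lemma cone_cases sigma : Sigma sigma ->
  [\/ forall y : lattice, sigma (real_point R y) -> y = 0,
    exists k, (forall i, sigma (vR i) <-> i = k) /\
      forall y : lattice, sigma (real_point R y) -> det2 (v k) y = 0 |
    exists k l, [/\ 0 < det2 (v k) (v l),
      forall i, sigma (vR i) <-> i = k \/ i = l &
      forall y : lattice, sigma (real_point R y) <->
        0 <= det2 (v k) y /\ 0 <= det2 y (v l)]].
Proof.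
move=> Ssigma; have [d [A [Afree sE]]] := stacky_simplicial hSigma Ssigma.
have : (d <= 2)%N by move: Afree; rewrite /row_free => /eqP <-; exact: rank_leq_col.
case: d A Afree sE => [|[|[|d]]] // A Afree sE _.
- apply: Or31 => y; rewrite sE => /cone_span0P/rowP e; apply/rowP => j.
  by have := e j; rewrite !mxE => /eqP; rewrite intr_eq0 => /eqP.
- apply: Or32; have s1 : simplicial_cone 1 sigma by exists A.
  have [k [sk ku]] := stacky_ray hSigma Ssigma s1.
  exists k; split=> [i|y sy].
    by split=> [/ku//|->].
  rewrite sE in sk sy.
  have [a _ ek] := proj1 (cone_span1P _ _) sk.
  have [b _ ey] := proj1 (cone_span1P _ _) sy.
  apply/eqP; rewrite -(intr_eq0 R) -det2_real ek ey det2ZZ det2xx mulr0 //.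
- apply: Or33; have D0 := row_free_det2 Afree.
  have sigmaE x : sigma x <-> exists c d : R, [/\ 0 <= c, 0 <= d &
      x = c *: real_point R (row 0 A) + d *: real_point R (row 1 A)].
    by rewrite sE cone_span2P.
  have [D1|D1] := ltrP 0 (det2 (row 0 A) (row 1 A)).
    exact: cone2_cases D1 sigmaE Ssigma.
  apply: (@cone2_cases _ (row 1 A) (row 0 A)) => //.
    by rewrite det2C oppr_gt0 lt_neqAle D0.
  by move=> x; rewrite sigmaE; split=> -[c [d [c0 d0 ->]]]; exists d, c; rewrite addrC.
Qed.

End Cones.

Lemma int_bound n (f : 'I_n -> int) : exists2 N : int, 0 < N & forall i, `|f i| < N.
Proof.
exists (1 + \sum_i `|f i|); first by rewrite ltr_wpDr // sumr_ge0.
move=> i; rewrite (bigD1 i) //= ltr_pwDl // lerDl; exact: sumr_ge0.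
Qed.

(** Lagrange's identity; for nonzero integer vectors it prevents [det2] and [dot2] from vanishing
    together. *)
Lemma det2_dot2 (K : comNzRingType) (x y : 'rV[K]_2) :
  dot2 x x * dot2 y y = det2 x y ^+ 2 + dot2 x y ^+ 2.
Proof. by rewrite /det2 /dot2; ring. Qed.

Lemma dot2_gt0 (u : lattice) : u != 0 -> 0 < dot2 u u.
Proof.
move=> u0; rewrite /dot2.
have [e0|e0] := eqVneq (u 0 0) 0; last first.
  by rewrite -!expr2 ltr_pwDl ?sqr_ge0 // exprn_even_gt0.
have [e1|e1] := eqVneq (u 0 1) 0; last first.
  by rewrite -!expr2 ltr_wpDl ?sqr_ge0 // exprn_even_gt0.
by case/eqP: u0; apply: rV2P; rewrite mxE.
Qed.

(** * The cyclic order of the rays *)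

Section FanCycle.
Variables (R : realType) (n : nat) (Sigma : set (set 'rV[R]_2)).
Variable v : 'I_n -> lattice.
Hypothesis hSigma : complete_stacky_fan Sigma v.

Local Notation vR i := (real_point R (v i)).

Lemma stacky_dot_gt0 i : 0 < dot2 (v i) (v i).
Proof. exact: dot2_gt0 (stacky_neq0 hSigma i). Qed.

(** Parallel vectors pointing the same way lie on one ray of the fan, and each ray carries a single
    chosen vector. *)
Lemma stacky_parallel i j : det2 (v i) (v j) = 0 -> 0 < dot2 (v i) (v j) -> i = j.
Proof.
move=> dij0 dotij.
have [rho [Srho rho1 rho_i]] := stacky_in_ray hSigma i.
apply: (stacky_ray_uniq hSigma Srho rho1 rho_i).
have [B [_ rhoE]] := rho1; rewrite rhoE in rho_i *.
have [a a0 ea] := proj1 (cone_span1P _ _) rho_i.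
apply/cone_span1P.
have ii := stacky_dot_gt0 i.
exists ((dot2 (v i) (v j))%:~R / (dot2 (v i) (v i))%:~R * a).
  by rewrite mulr_ge0 // divr_ge0 // ler0z ltW.
rewrite -scalerA -ea.
have iiR : (dot2 (v i) (v i))%:~R != 0 :> R by rewrite intr_eq0 gt_eqF.
have e c : dot2 (v i) (v i) * v j 0 c = dot2 (v i) (v j) * v i 0 c ->
    vR j 0 c = ((dot2 (v i) (v j))%:~R / (dot2 (v i) (v i))%:~R *: vR i) 0 c.
  move=> /(congr1 (fun z : int => z%:~R : R)); rewrite !rmorphM !mxE => e.
  by rewrite mulrAC -e mulrAC divff // mul1r.
apply: rV2P; apply: e; apply/eqP; rewrite -subr_eq0.
  have -> : dot2 (v i) (v i) * v j 0 0 - dot2 (v i) (v j) * v i 0 0 =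
      - v i 0 1 * det2 (v i) (v j) by rewrite /dot2 /det2; ring.
  by rewrite dij0 mulr0.
have -> : dot2 (v i) (v i) * v j 0 1 - dot2 (v i) (v j) * v i 0 1 =
    v i 0 0 * det2 (v i) (v j) by rewrite /dot2 /det2; ring.
by rewrite dij0 mulr0.
Qed.

(** A cone containing a vector turned slightly counterclockwise from [v i], off all the rays, is
    two-dimensional, and its clockwise edge can only be [v i]. *)
Lemma stacky_cone_next i : exists j sigma, [/\ Sigma sigma,
  0 < det2 (v i) (v j) & forall k, sigma (vR k) <-> k = i \/ k = j].
Proof.
(* For N large, y lies just counterclockwise of v i. *)
have [N N0 dotN] := int_bound (fun j => dot2 (v i) (v j)).
pose y : lattice := N *: v i + \row_j (if j == 0 then - v i 0 1 else v i 0 0).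
have yE j : det2 y (v j) = N * det2 (v i) (v j) - dot2 (v i) (v j).
  by rewrite /det2 /dot2 !mxE /=; ring.
have ii := stacky_dot_gt0 i.
have y_neg j : det2 y (v j) < 0 -> det2 (v i) (v j) < 0 \/ j = i.
  move=> yj; have [->|ij] := eqVneq j i; [by right | left].
  rewrite ltNge; apply/negP => aij; have [a0|a0] := eqVneq (det2 (v i) (v j)) 0.
    move/negP: ij; apply; apply/eqP/esym/stacky_parallel => //.
    by move: yj; rewrite yE a0 mulr0 sub0r oppr_lt0.
  by move: yj; have := dotN j; rewrite yE; nia.
have y_pos j : 0 < det2 y (v j) -> 0 <= det2 (v i) (v j).
  by have := dotN j; rewrite yE; nia.
have y_neq0 j : det2 y (v j) != 0.
  apply/eqP => yj; have jj := stacky_dot_gt0 j.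
  have := det2_dot2 (v i) (v j); have := dotN j; move: yj; rewrite yE.
  have [->|a0] := eqVneq (det2 (v i) (v j)) 0.
    by rewrite mulr0 sub0r => /eqP; rewrite oppr_eq0 => /eqP ->; nia.
  by nia.
have [sigma Ss sy] := stacky_complete hSigma (real_point R y).
have [s0|[k [_ sk]]|[k [l [kl sI sE]]]] := cone_cases hSigma Ss.
- by have /eqP := y_neq0 i; rewrite (s0 _ sy) /det2 !mxE !mul0r subrr.
- by have := y_neq0 k; rewrite det2C sk // oppr0 eqxx.
have [ky yl] := proj1 (sE _) sy.
have yk : det2 y (v k) < 0.
  by rewrite lt_neqAle y_neq0 det2C oppr_le0.
have {}yl : 0 < det2 y (v l) by rewrite lt_def y_neq0.
suff ki : k = i by rewrite ki in kl sI; exists l, sigma.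
(* If [v k] were strictly clockwise of [v i], then [v i] would lie in [sigma] and be one of its
   edges; it cannot be [v l], which is counterclockwise of [y]. *)
have [ik|//] := y_neg _ yk.
have si : sigma (vR i).
  by apply/sE; split; [rewrite det2C oppr_ge0 ltW | exact: y_pos].
have [ei|ei] := proj1 (sI _) si; first by [].
by move: yl; rewrite -ei yE det2xx mulr0 sub0r; lia.
Qed.

(** When two plane cones have the same clockwise or the same counterclockwise edge, the nearer of
    the two remaining edges lies in both by convexity, hence is an edge of both. *)
Lemma stacky_cone2_uniq sigma tau i j k l : Sigma sigma -> Sigma tau ->
  0 < det2 (v i) (v j) -> 0 < det2 (v k) (v l) ->
  (forall m, sigma (vR m) <-> m = i \/ m = j) ->
  (forall m, tau (vR m) <-> m = k \/ m = l) ->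
  (i = k \/ j = l) -> i = k /\ j = l.
Proof.
have convex rho m m' w : Sigma rho -> 0 < det2 (v m) (v m') ->
    rho (vR m) -> rho (vR m') -> 0 <= det2 (v m) (v w) ->
    0 <= det2 (v w) (v m') -> rho (vR w).
  move=> Srho mm' rm rm' mw wm'.
  have [r0|[a [ra _]]|[a [b [ab rI rE]]]] := cone_cases hSigma Srho.
  - by have := stacky_neq0 hSigma m; rewrite (r0 _ rm) eqxx.
  - by move: mm'; rewrite (proj1 (ra _) rm) (proj1 (ra _) rm') det2xx ltxx.
  have [am mb] := proj1 (rE _) rm; have [am' mb'] := proj1 (rE _) rm'.
  apply/rE; split.
    rewrite -(pmulr_rge0 _ mm').
    have -> : det2 (v m) (v m') * det2 (v a) (v w) =
        det2 (v w) (v m') * det2 (v a) (v m) + det2 (v m) (v w) * det2 (v a) (v m').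
      by rewrite /det2; ring.
    by rewrite addr_ge0 // mulr_ge0.
  rewrite -(pmulr_rge0 _ mm').
  have -> : det2 (v m) (v m') * det2 (v w) (v b) =
      det2 (v w) (v m') * det2 (v m) (v b) + det2 (v m) (v w) * det2 (v m') (v b).
    by rewrite /det2; ring.
  by rewrite addr_ge0 // mulr_ge0.
move=> Ss St ij kl sI tI.
have si : sigma (vR i) by apply/sI; left.
have sj : sigma (vR j) by apply/sI; right.
have tk : tau (vR k) by apply/tI; left.
have tl : tau (vR l) by apply/tI; right.
have nij : i <> j by move=> e; rewrite e det2xx ltxx in ij.
have nkl : k <> l by move=> e; rewrite e det2xx ltxx in kl.
case=> e; subst.
  split=> //; have [jl|lj] := lerP 0 (det2 (v j) (v l)).
    have /tI[] : tau (vR j) by apply: (convex tau k l j) => //; exact: ltW.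
      by move=> e; case: nij.
    by [].
  have /sI[] : sigma (vR l).
    by apply: (convex sigma k j l) => //; first exact: ltW; rewrite det2C oppr_ge0 ltW.
    by move=> e; case: nkl.
  by [].
split=> //; have [ik|ki] := lerP 0 (det2 (v i) (v k)).
  have /sI[] : sigma (vR k) by apply: (convex sigma i l k) => //; exact: ltW.
    by [].
  by move=> e; case: nkl.
have /tI[] : tau (vR i).
  by apply: (convex tau k l i) => //; last exact: ltW; rewrite det2C oppr_ge0 ltW.
  by [].
by move=> e; case: nij.
Qed.

(** [nx i] is the other edge of the plane cone counterclockwise of [v i]. That [nx] forms a single
    cycle is obtained later, in [nsplits_connected]. *)
Theorem stacky_cycle : exists nx : 'I_n -> 'I_n,
  [/\ injective nx, forall i, 0 < det2 (v i) (v (nx i)),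
    forall i, exists2 sigma, Sigma sigma &
      forall k, sigma (vR k) <-> k = i \/ k = nx i &
    forall sigma j, Sigma sigma -> sigma (vR j) ->
      exists i, forall k, sigma (vR k) -> k = i \/ k = nx i].
Proof.
have [nx nxP] := choice stacky_cone_next.
exists nx; split.
- move=> i j eij; have [s [Ss si sI]] := nxP i; have [t [St tj tI]] := nxP j.
  by have [|//] := stacky_cone2_uniq Ss St si tj sI tI; right.
- by move=> i; have [s []] := nxP i.
- by move=> i; have [s [Ss _ sI]] := nxP i; exists s.
move=> s j Ss sj; have [s0|[k [sk _]]|[k [l [kl sI _]]]] := cone_cases hSigma Ss.
- by have := stacky_neq0 hSigma j; rewrite (s0 _ sj) eqxx.
- by exists k => m /sk; left.
have [t [St tk tI]] := nxP k.
exists k => m /sI.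
by have [|_ <-] := stacky_cone2_uniq Ss St kl tk sI tI; first by left.
Qed.

End FanCycle.

(** * Independence and separation of characters *)

(** In Smith coordinates the row lattice consists of the vectors whose entries are divisible by the
    invariant factors, the factor being 0 past the rank. An entry of [m] that fails this gives [c]
    and [d]. *)
Lemma row_lattice_separation k n (A : 'M[int]_(k, n)) (m : 'rV[int]_n) :
  (forall w : 'rV_k, m <> w *m A) ->
  exists (c : 'cV[int]_n) (d : int),
    (forall j, (d %| ((A *m c) j 0)%R)%Z) /\ ~~ (d %| ((m *m c) 0 0)%R)%Z.
Proof.
move=> mA; have [L Lu [Q Qu [d _ AE]]] := int_Smith_normal_form A.
set D := \matrix_(i, j) _ in AE.
pose mu := m *m invmx Q.
pose dd (i : 'I_n) : int := if (i < k)%N then d`_i else 0.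
have [i dmu|dmu] := pickP (fun i => ~~ (dd i %| (mu 0 i)%R)%Z).
  exists (col i (invmx Q)), (dd i); split; last first.
    by rewrite colE mulmxA -colE mxE.
  move=> j; rewrite AE -mulmxA colE (mulmxA Q) mulmxV // mul1mx -mulmxA mxE.
  apply: rpred_sum => l _; apply: dvdz_mull; rewrite -colE !mxE /dd.
  by case: eqP => [<-|_]; rewrite ?ltn_ord ?mulr1n ?mulr0n ?dvdz0.
exfalso; pose w' : 'rV_k := \row_j (if insub (val j) is Some i then
   ((mu 0 i)%R %/ d`_j)%Z else 0).
apply: (mA (w' *m invmx L)).
rewrite AE !mulmxA mulmxKV // -[LHS](mulmxKV Qu) -/mu; congr (_ *m _).
apply/rowP => i; rewrite [RHS]mxE.
have /negbFE := dmu i; rewrite /dd.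
case: ltnP => [ik|ki] dvd_mu.
  rewrite (bigD1 (Ordinal ik)) //= big1 ?addr0; last first.
    move=> j; rewrite -val_eqE /= => ji; rewrite !mxE.
    by case: eqP => [e|_]; [rewrite e eqxx in ji | rewrite mulr0n mulr0].
  by rewrite [w' _ _]mxE [D _ _]mxE /= eqxx mulr1n valK divzK.
move: dvd_mu; rewrite dvd0z => /eqP ->; rewrite big1 // => j _; rewrite !mxE.
by case: eqP => [e|_]; [have := ltn_ord j; rewrite e; lia | rewrite mulr0n mulr0].
Qed.

Section Characters.
Variable C : numClosedFieldType.

Lemma prim_root_exists d : (0 < d)%N -> exists z : C, d.-primitive_root z.
Proof.
pose p : {poly C} := 'X^d - 1; have [r Dp] := closed_field_poly_normal p.
move=> d_gt0; rewrite (monicP _) ?monicXnsubC // scale1r in Dp.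
have rd1 : all d.-unity_root r by apply/allP => z; rewrite -root_prod_XsubC -Dp.
have sz_r : (d < (size r).+1)%N.
  by rewrite -(size_prod_XsubC r id) -Dp size_XnsubC.
have [|z] := hasP (has_prim_root d_gt0 rd1 _ sz_r); last by exists z.
by rewrite -separable_prod_XsubC -Dp separable_Xn_sub_1 // pnatr_eq0 -lt0n.
Qed.

(** A primitive root of unity of order [|d|], or the number 2, of infinite order, when [d] is 0. *)
Lemma kernel_root_exists (d : int) :
  exists2 z : C, z != 0 & forall a : int, z ^ a = 1 <-> (d %| a)%Z.
Proof.
have [->|d0] := eqVneq d 0.
  exists 2 => [|a]; first by rewrite pnatr_eq0.
  rewrite dvd0z; split=> [|/eqP -> //]; case: a => a; last first.
    move=> /(congr1 GRing.inv); rewrite NegzE invr_expz opprK invr1 => /eqP.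
    by rewrite -exprnP pexpr_eq1 // ?ler0n // pnatr_eq1.
  by case: a => // a /eqP; rewrite -exprnP pexpr_eq1 // ?ler0n // pnatr_eq1.
have d_gt0 : (0 < `|d|)%N by rewrite absz_gt0.
have [z zP] := prim_root_exists d_gt0; exists z => [|a].
  apply/eqP => z0; have /eqP := prim_expr_order zP.
  by rewrite z0 expr0n absz_eq0 (negbTE d0) eq_sym oner_eq0.
rewrite dvdzE; case: a => a /=.
  by rewrite (prim_order_dvd zP) -exprnP; exact: (rwP eqP).
rewrite (prim_order_dvd zP) NegzE -invr_expz -exprnP.
by rewrite -invr_eq1; exact: (rwP eqP).
Qed.

Lemma exprz_sum (z : C) I (r : seq I) (F : I -> int) : z != 0 ->
  z ^ (\sum_(i <- r) F i) = \prod_(i <- r) z ^ F i.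
Proof. by move=> z0; apply: (big_morph _ _ (expr0z z)) => a b; exact: expfzDr. Qed.

Variable n : nat.
Implicit Types (m : 'rV[int]_n) (x y : 'I_n -> C).

Definition monomial m x : C := \prod_i x i ^ m 0 i.

Definition torus x : Prop := forall i, x i != 0.

Lemma monomialD m m' x : torus x -> monomial (m + m') x = monomial m x * monomial m' x.
Proof.
by move=> x0; rewrite -big_split; apply: eq_bigr => i _; rewrite mxE expfzDr.
Qed.

Lemma monomialM m x y : monomial m (fun i => x i * y i) = monomial m x * monomial m y.
Proof. by rewrite -big_split; apply: eq_bigr => i _; rewrite expfzMl. Qed.

Lemma monomial_neq0 m x : torus x -> monomial m x != 0.
Proof. by move=> x0; apply/prodf_neq0 => i _; rewrite expfz_neq0. Qed.

Lemma torusM x y : torus x -> torus y -> torus (fun i => x i * y i).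
Proof. by move=> x0 y0 i; rewrite mulf_neq0. Qed.

Lemma monomial_inj m m' : (forall x, torus x -> monomial m x = monomial m' x) -> m = m'.
Proof.
move=> mm'; apply/rowP => i; have [z z0 zP] := kernel_root_exists 0.
have monE k : monomial k (fun j => if j == i then z else 1) = z ^ k 0 i.
  rewrite /monomial (bigD1 i) //= eqxx big1 ?mulr1 // => j /negbTE ->.
  exact: exp1rz.
have /mm' : torus (fun j => if j == i then z else 1).
  by move=> j; case: ifP; rewrite ?oner_eq0.
rewrite !monE => e; apply/eqP; rewrite -subr_eq0 -dvd0z; apply/zP.
by rewrite expfzDr // e -expfzDr // subrr expr0z.
Qed.

(* Dedekind's independence of characters. *)
Lemma monomial_free (S : seq 'rV[int]_n) (c : 'rV[int]_n -> C) : uniq S ->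
  (forall x, torus x -> \sum_(m <- S) c m * monomial m x = 0) ->
  forall m, m \in S -> c m = 0.
Proof.
elim: S c => // m0 S IH c /= /andP[m0S uS] cS.
have cS0 m : m \in S -> c m = 0.
  move=> mS; have m0m : m <> m0 by move=> e; rewrite -e mS in m0S.
  have [y [y0 ym]] : exists y, torus y /\ monomial m y != monomial m0 y.
    apply: contrapT => ny; apply: m0m; apply: monomial_inj => y y0.
    by apply: contrapT => /eqP ym; apply: ny; exists y.
  have := IH (fun m => c m * (monomial m y - monomial m0 y)) uS _ m mS.
  move=> /(_ _)/eqP; rewrite mulf_eq0 subr_eq0 (negbTE ym) orbF => H.
  apply/eqP/H => x x0.
  have := cS _ (torusM y0 x0); have /(congr1 ( *%R (monomial m0 y))) := cS _ x0.
  rewrite !big_cons mulr0 => e0 e1.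
  have {e0 e1} := etrans e1 (esym e0).
  rewrite mulrDr mulr_sumr monomialM mulrCA => /addrI/eqP.
  rewrite -subr_eq0 -sumrB => /eqP e; rewrite -[RHS]e; apply: eq_bigr => k _.
  by rewrite monomialM; ring.
move=> m; rewrite inE => /predU1P[->|/cS0//].
have one0 : torus (fun=> 1) by move=> i; rewrite oner_eq0.
have := cS _ one0; rewrite big_cons big_seq big1 => [|k kS]; last first.
  by rewrite cS0 ?mul0r.
by rewrite addr0 => /eqP; rewrite mulf_eq0 (negbTE (monomial_neq0 _ one0)) orbF => /eqP.
Qed.

End Characters.

(** * Monomial expansion of sections *)

Section Sections.
Variables (R : realType) (n : nat).
Variables (v : 'I_n -> lattice).
Local Notation C := (R[i]).
Local Notation vR i := (real_point R (v i)).
Implicit Types (m r : 'rV[int]_n) (x zeta : 'I_n -> C).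
Implicit Types (sigma : set 'rV[R]_2) (f : ('I_n -> C) -> C).

Lemma in_G_monomial zeta w : in_G v zeta -> monomial (char_divisor v w) zeta = 1.
Proof. by move=> [_ zG]; rewrite -[RHS](zG w); apply: eq_bigr => i _; rewrite mxE. Qed.

(** Otherwise a covector [c] separates [m] modulo [d] from the image of the dual lattice, and the
    point with coordinates [z ^ c i 0], where [z] has kernel generated by [d], lies in G but is not
    killed by [m]. *)
Lemma in_G_separates m :
  (forall zeta, in_G v zeta -> monomial m zeta = 1) ->
  exists w, m = char_divisor v w.
Proof.
move=> mG; apply: contrapT => nw.
pose A : 'M[int]_(2, n) := \matrix_(j, i) v i 0 j.
have AE w : char_divisor v w^T = w *m A.
  apply/rowP => i; rewrite !mxE /pairing mxE; apply: eq_bigr => j _.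
  by rewrite !mxE mulrC.
have [|c [d [dA dm]]] := @row_lattice_separation _ _ A m.
  by move=> w e; apply: nw; exists w^T; rewrite AE.
have [z z0 zP] := kernel_root_exists C d.
pose zeta i := z ^ c i 0.
have monE k : monomial k zeta = z ^ ((k *m c) 0 0).
  rewrite mxE exprz_sum //; apply: eq_bigr => i _.
  by rewrite /zeta exprz_exp mulrC.
have : monomial m zeta = 1.
  apply: mG; split=> [i|w]; first exact: expfz_neq0.
  transitivity (monomial (char_divisor v w) zeta).
    by apply: eq_bigr => i _; rewrite mxE.
  rewrite -[w]trmxK AE monE; apply/zP.
  rewrite -mulmxA mxE; apply: rpred_sum => j _.
  exact/dvdz_mull/dA.
by rewrite monE => /zP; apply/negP.
Qed.

Lemma chart_torus sigma x : torus x -> chart v sigma x.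
Proof. by move=> x0 i xi; have := x0 i; rewrite xi eqxx. Qed.

(** Regularity of the Laurent monomial [m] on the chart, where only the coordinates of rays outside
    [sigma] are inverted. *)
Definition effective_on sigma m : Prop := forall i, sigma (vR i) -> 0 <= m 0 i.

Local Notation outside sigma x := (\prod_(i | vR i \notin sigma) x i).

Lemma outside_neq0 sigma x : chart v sigma x -> outside sigma x != 0.
Proof.
move=> Ux; apply/prodf_neq0 => i /negP iS; apply/eqP => xi; apply: iS.
by rewrite inE; apply: Ux.
Qed.

Lemma regular0 sigma : regular_on_chart v sigma (fun=> 0 : C).
Proof. by exists 0, 0%N => x _; rewrite meval0 mul0r. Qed.

Lemma regularD sigma f g : regular_on_chart v sigma f ->
  regular_on_chart v sigma g -> regular_on_chart v sigma (fun x => f x + g x).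
Proof.
move=> [p [k fE]] [q [l gE]].
pose D : {mpoly C[n]} := \prod_(i | vR i \notin sigma) 'X_i.
have DE x : D.@[x] = outside sigma x.
  by rewrite rmorph_prod /=; apply: eq_bigr => i _; rewrite mevalXU.
exists (p * D ^+ l + q * D ^+ k), (k + l)%N => x Ux.
rewrite fE // gE // mevalD !mevalM !rmorphXn /= DE.
have := outside_neq0 Ux; move: (outside sigma x) => d d0.
by rewrite exprD; field; rewrite !expf_neq0.
Qed.

Lemma regular_monomial sigma m (c : C) : effective_on sigma m ->
  regular_on_chart v sigma (fun x => c * monomial m x).
Proof.
(* This [k] bounds every [|m 0 i|], so the [k]-th power of the product of the outside coordinates
   clears all denominators. *)
move=> m_ge0; pose k := (\sum_i `|m 0%R i|)%N.
pose m' := [multinom `|(m 0 i + (if vR i \notin sigma then k%:Z else 0))%R|%N | i < n].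
exists (c *: 'X_[m']), k => x Ux.
apply: (canRL (mulfK (expf_neq0 k (outside_neq0 Ux)))).
rewrite mevalZ mevalX -mulrA; congr (_ * _).
rewrite -prodrXl (big_mkcond (fun i => vR i \notin sigma)) -big_split /=.
apply: eq_bigr => i _; rewrite mnmE.
have mk : `|m 0 i| <= k%:Z.
  by rewrite /k (bigD1 i) //= PoszD abszE lerDl.
case: ifP => iS.
  have xi : x i != 0.
    by apply/eqP => xi; move/negP: iS; apply; rewrite inE; apply: Ux.
  by rewrite !exprnP gez0_abs ?expfzDr //; lia.
have si : sigma (vR i) by move/negbFE: iS; rewrite inE.
by rewrite mulr1 addr0 exprnP gez0_abs // m_ge0.
Qed.

Lemma regular_expand sigma f : regular_on_chart v sigma f ->
  exists (S : seq 'rV[int]_n) (c : 'rV[int]_n -> C), [/\ uniq S,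
    forall m, m \notin S -> c m = 0,
    forall m, c m != 0 -> effective_on sigma m &
    forall x, chart v sigma x -> f x = \sum_(m <- S) c m * monomial m x].
Proof.
move=> [p [k fE]].
(* Dividing by the [k]-th power lowers the exponents outside [sigma] by [k]; those of the rays in
   [sigma] stay nonnegative. *)
pose eps (m : 'X_{1..n}) : 'rV[int]_n :=
  \row_i ((m i)%:Z - (if vR i \notin sigma then k%:Z else 0)).
pose c m : C := \sum_(m' <- msupp p | eps m' == m) p@_m'.
exists (undup (map eps (msupp p))), c; split; first exact: undup_uniq.
- move=> m; rewrite mem_undup => mS; rewrite /c big_seq_cond big1 // => m'.
  by move=> /andP[m'p /eqP em]; move: mS; rewrite -em map_f.
- move=> m cm i si.
  have [a <-] : exists a : 'X_{1..n}, eps a = m.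
    apply: contrapT => nm; move/eqP: cm; apply; rewrite /c big1 // => m' /eqP em.
    by case: nm; exists m'.
  by rewrite mxE mem_set //= subr0.
move=> x Ux; rewrite fE //.
have monE (a : 'X_{1..n}) :
    monomial (eps a) x * outside sigma x ^+ k = \prod_i x i ^+ a i.
  rewrite -prodrXl (big_mkcond (fun i => vR i \notin sigma)) -big_split /=.
  apply: eq_bigr => i _; rewrite mxE; case: ifP => iS.
    have xi : x i != 0.
      by apply/eqP => xi; move/negP: iS; apply; rewrite inE; apply: Ux.
    by rewrite !exprnP -expfzDr // subrK.
  by rewrite subr0 mulr1.
have D0 := expf_neq0 k (outside_neq0 Ux).
rewrite mevalE mulr_suml.
under [RHS]eq_bigr => m _ do rewrite /c mulr_suml.
under [RHS]eq_bigr => m _ do rewrite big_mkcond /=.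
rewrite exchange_big /= big_seq [RHS]big_seq; apply: eq_bigr => m mp.
rewrite (bigD1_seq (eps m)) ?undup_uniq ?mem_undup ?map_f //= eqxx.
rewrite [X in _ + X]big1 ?addr0 ; last first.
  by move=> m' /negbTE; rewrite eq_sym => ->.
by rewrite -monE mulrA mulfK.
Qed.

End Sections.

Lemma sum_uniq_support (V : nmodType) (I : eqType) (S S' : seq I) (F : I -> V) :
  uniq S -> uniq S' -> {subset S <= S'} -> (forall i, i \notin S -> F i = 0) ->
  \sum_(i <- S') F i = \sum_(i <- S) F i.
Proof.
move=> uS uS' SS' F0; rewrite (bigID (mem S)) /= [X in _ + X]big1 // addr0.
rewrite -big_filter; apply: perm_big; apply: uniq_perm; rewrite ?filter_uniq //.
by move=> i; rewrite mem_filter andb_idr //; apply: SS'.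
Qed.

(** * The grading of the Cech complex by exponents *)

Section Graded.
Variables (R : realType) (n : nat) (Sigma : set (set 'rV[R]_2)).
Variables (v : 'I_n -> lattice).
Hypothesis Sigma_fin : finite_set Sigma.
Local Notation C := (R[i]).
Local Notation vR i := (real_point R (v i)).
Implicit Types (m r : 'rV[int]_n) (x zeta : 'I_n -> C).
Implicit Types (sigma : set 'rV[R]_2) (f : ('I_n -> C) -> C).

Definition incident sigma i : Prop := sigma (vR i).

Definition negative m : pred 'I_n := fun i => m 0 i < 0.

Definition in_class r m : Prop := exists w, m = r + char_divisor v w.

Lemma section0 r sigma : line_bundle_section v r sigma (fun=> 0 : C).
Proof. by split=> [|zeta x _ _]; [exact: regular0 | rewrite mul0r]. Qed.

Lemma section_sum r sigma (I : Type) (s : seq I) (F : I -> ('I_n -> C) -> C) :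
  (forall i, line_bundle_section v r sigma (F i)) ->
  line_bundle_section v r sigma (fun x => \sum_(i <- s) F i x).
Proof.
move=> FP; elim: s => [|i s [IHr IHG]].
  by under eq_fun do rewrite big_nil; apply: section0.
under eq_fun do rewrite big_cons; split.
  by apply: regularD => //; case: (FP i).
move=> zeta x Gz Ux; rewrite IHG // mulrDl; congr (_ + _).
by case: (FP i) => _ ->.
Qed.

Lemma section_monomial r sigma m (c : C) : in_class r m -> effective_on v sigma m ->
  line_bundle_section v r sigma (fun x => c * monomial m x).
Proof.
move=> [w ->] m_ge0; split=> [|zeta x Gz Ux]; first exact: regular_monomial.
rewrite monomialM monomialD; last by case: Gz.
by rewrite (in_G_monomial _ Gz) mulr1 mulrA mulrAC.
Qed.

(** By independence of characters, equivariance holds monomial by monomial: each exponent that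
    occurs has the same character on G as [r], and [in_G_separates] puts it in the class of [r]. *)
Lemma section_expand r sigma f : line_bundle_section v r sigma f ->
  exists (S : seq 'rV[int]_n) (c : 'rV[int]_n -> C), [/\ uniq S,
    forall m, m \notin S -> c m = 0,
    forall m, c m != 0 -> effective_on v sigma m /\ in_class r m &
    forall x, chart v sigma x -> f x = \sum_(m <- S) c m * monomial m x].
Proof.
move=> [freg fG]; have [S [c [uS cS c_eff fE]]] := regular_expand freg.
exists S, c; split=> // m cm; split; first exact: c_eff.
have mS : m \in S by apply: contraNT cm => /cS ->.
have [w mw] : exists w, m - r = char_divisor v w.
  apply: (@in_G_separates R) => zeta Gz; have z0 := proj1 Gz.
  suff e : monomial m zeta = monomial r zeta.
    apply: (mulfI (monomial_neq0 r z0)).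
    by rewrite -monomialD // addrC subrK mulr1.
  have := @monomial_free _ _ S (fun m => c m * (monomial m zeta - monomial r zeta)) uS _ m mS.
  move=> /(_ _)/eqP; rewrite mulf_eq0 (negbTE cm) subr_eq0 /= => H.
  apply/eqP/H => x x0.
  have Ux := chart_torus v sigma x0.
  have Uzx := chart_torus v sigma (torusM z0 x0).
  have := fG zeta x Gz Ux; rewrite !fE // => /eqP.
  rewrite -subr_eq0 mulr_suml -sumrB => /eqP e; rewrite -[RHS]e.
  apply: eq_bigr => k _; rewrite monomialM -/(monomial r zeta); ring.
by exists w; rewrite -mw addrC subrK.
Qed.

(** There are finitely many tuples of cones, so one finite list of exponents serves all components
    of a cochain at once. *)
Lemma cochain_expand r p (b : cochain R n p) : is_cochain Sigma v r b ->
  exists (S : seq 'rV[int]_n) (c : ('I_p.+1 -> set 'rV[R]_2) -> 'rV[int]_n -> C),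
    uniq S /\ forall s, cones_of Sigma s -> [/\
      forall m, m \notin S -> c s m = 0,
      forall m, c s m != 0 -> effective_on v (meet_of s) m /\ in_class r m &
      forall x, chart v (meet_of s) x ->
        b s x = \sum_(m <- S) c s m * monomial m x].
Proof.
move=> bP.
have /choice[S] : forall s, exists S : seq 'rV[int]_n, cones_of Sigma s ->
    exists c : 'rV[int]_n -> C, [/\ uniq S,
    forall m, m \notin S -> c m = 0,
    forall m, c m != 0 -> effective_on v (meet_of s) m /\ in_class r m &
    forall x, chart v (meet_of s) x -> b s x = \sum_(m <- S) c m * monomial m x].
  move=> s; have [Ss|nSs] := pselect (cones_of Sigma s); last by exists nil.
  by have [S [c cP]] := section_expand (bP s Ss); exists S => _; exists c.
move=> SP; have /choice[c cP] : forall s, exists c : 'rV[int]_n -> C,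
    cones_of Sigma s -> [/\ uniq (S s),
    forall m, m \notin S s -> c m = 0,
    forall m, c m != 0 -> effective_on v (meet_of s) m /\ in_class r m &
    forall x, chart v (meet_of s) x -> b s x = \sum_(m <- S s) c m * monomial m x].
  move=> s; have [Ss|nSs] := pselect (cones_of Sigma s); last by exists (fun=> 0).
  by have [c cP] := SP s Ss; exists c.
have [L SigmaE] := proj1 (finite_seqP _) Sigma_fin.
pose st (t : {ffun 'I_p.+1 -> 'I_(size L)}) k := nth set0 L (t k).
exists (undup (flatten [seq S (st t) | t <- enum {ffun 'I_p.+1 -> 'I_(size L)}])), c.
split=> [|s Ss]; first exact: undup_uniq.
set S' := undup _; have [uS cS c_eff bE] := cP s Ss.
have SS' : {subset S s <= S'}.
  have sL k : (index (s k) L < size L)%N by have := Ss k; rewrite SigmaE /= -index_mem.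
  have -> : s = st [ffun k => Ordinal (sL k)].
    apply: funext => k; rewrite /st ffunE /= nth_index //.
    by rewrite -index_mem.
  move=> m mS; rewrite mem_undup; apply/flatten_mapP.
  by exists [ffun k => Ordinal (sL k)] => //; rewrite mem_enum.
split=> // [m mS'|x Ux]; first by apply: cS; apply: contraNN mS'; apply: SS'.
rewrite bE //; apply/esym/sum_uniq_support => //; first exact: undup_uniq.
by move=> m mS; rewrite cS ?mul0r.
Qed.

Lemma shareP m p (s : 'I_p -> set 'rV[R]_2) :
  share incident (negative m) s <-> ~ effective_on v [set y | forall k, s k y] m.
Proof.
split=> [[i mi si] /(_ i si)|meff]; first by rewrite leNgt (_ : m 0 i < 0 = true).
apply: contrapT => ns; apply: meff => i si; rewrite leNgt; apply/negP => mi.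
by apply: ns; exists i.
Qed.

Lemma cech_d_monomials p (S : seq 'rV[int]_n)
    (c : ('I_p.+1 -> set 'rV[R]_2) -> 'rV[int]_n -> C) (b : cochain R n p) s x :
  (forall k : 'I_p.+2, b (fun l => s (lift k l)) x =
     \sum_(m <- S) c (fun l => s (lift k l)) m * monomial m x) ->
  cech_d b s x = \sum_(m <- S) delta (fun s' => c s' m) s * monomial m x.
Proof.
move=> bE; under [RHS]eq_bigr => m _ do rewrite /delta mulr_suml.
rewrite exchange_big; apply: eq_bigr => k _; rewrite bE mulr_sumr.
by apply: eq_bigr => m _; rewrite mulrA.
Qed.

Lemma cones_of_lift p (s : 'I_p.+1 -> set 'rV[R]_2) k :
  cones_of Sigma s -> all_in Sigma (fun l => s (lift k l)).
Proof. by move=> Ss m; apply: Ss. Qed.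

Let torus1 : torus (fun _ : 'I_n => 1 : C) := fun i => oner_neq0 C.

Let monomial1 m : monomial m (fun=> 1 : C) = 1.
Proof. by rewrite /monomial big1 // => i _; rewrite exp1rz. Qed.

(** Without a negative exponent the monomial itself would be a nonzero global section. *)
Lemma H_trivial_negative r m : Sigma !=set0 -> H_trivial_bundle Sigma v r ->
  in_class r m -> exists i, negative m i.
Proof.
move=> [sigma Ssigma] Hr rm; apply: contrapT => nneg.
have m_ge0 i : 0 <= m 0 i.
  by rewrite leNgt; apply/negP => mi; apply: nneg; exists i.
pose c : cochain R n 0 := fun _ x => 1 * monomial m x.
have /Hr/(_ (fun=> sigma) (fun=> Ssigma) (fun=> 1)) : is_cocycle Sigma v r c.
  split=> [s Ss|s Ss x _]; first exact: section_monomial.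
  by rewrite /cech_d !big_ord_recl big_ord0 /= expr0 expr1 mul1r mulN1r addr0 subrr.
rewrite /c monomial1 mulr1 => /(_ (chart_torus _ _ torus1))/eqP.
by rewrite oner_eq0.
Qed.

(** Multiplication by the monomial [m] maps the relative complex into the Cech complex, and the
    coefficient of [m] in a Cech primitive is a relative primitive. *)
Lemma H_trivial_graded r m : H_trivial_bundle Sigma v r -> in_class r m ->
  relative_exact C Sigma incident (negative m).
Proof.
move=> Hr rm p a ra da.
pose c : cochain R n p := fun s x => a s * monomial m x.
have cc : is_cocycle Sigma v r c.
  split=> [s Ss|s Ss x _].
    have [a0|a0] := eqVneq (a s) 0.
      by rewrite /c a0; under eq_fun do rewrite mul0r; apply: section0.
    apply: section_monomial => //; apply: contrapT => /shareP ns.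
    by rewrite ra ?eqxx in a0.
  rewrite (@cech_d_monomials _ [:: m] (fun s _ => a s)).
    by rewrite big_seq1 da ?mul0r.
  by move=> k; rewrite big_seq1.
have cE s x : c s x = a s * monomial m x by [].
case: p a ra da c cc cE => [|p] a ra da c cc cE.
  exists (fun=> 0); split=> // s Ss.
  have := Hr _ _ cc s Ss (fun=> 1) (chart_torus _ _ torus1).
  by rewrite cE monomial1 mulr1 => ->; rewrite /delta big1 // => k _; rewrite mulr0.
have [b [bb cb]] := Hr _ _ cc.
have [S [d [uS dP]]] := cochain_expand bb.
exists (fun s => d s m); split=> [s Ss /shareP ns|s Ss].
  have [_ d_eff _] := dP s Ss; apply/eqP; apply: contrapT => /negP /d_eff[].
  by move=> /ns.
pose S' := undup (m :: S).
(* The coefficients of the difference between the cocycle and the coboundary of its primitive; they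
   vanish by independence of monomials. *)
pose e m' := (if m' == m then a s else 0) - delta (fun s' => d s' m') s.
suff /eqP : e m = 0 by rewrite /e eqxx subr_eq0 => /eqP.
apply: (@monomial_free _ _ S' e); rewrite ?undup_uniq ?mem_undup ?mem_head // => x x0.
under eq_bigr do rewrite mulrBl.
rewrite sumrB (sum_uniq_support (S := [:: m])) ?undup_uniq //; last first.
- by move=> i; rewrite inE => /negbTE ->; rewrite mul0r.
- by move=> i; rewrite inE => /eqP ->; rewrite mem_undup mem_head.
rewrite big_seq1 eqxx -cE (cb s Ss x (chart_torus _ _ x0)).
rewrite (sum_uniq_support uS) ?undup_uniq //; last first.
- move=> i iS; rewrite /delta big1 ?mul0r // => k _.
  by have [-> //] := dP _ (cones_of_lift k Ss); rewrite mulr0.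
- by move=> i iS; rewrite mem_undup inE iS orbT.
rewrite (@cech_d_monomials _ S d) ?subrr // => k.
have [_ _ -> //] := dP _ (cones_of_lift k Ss).
exact: chart_torus.
Qed.

(** Primitives are found exponent by exponent and summed over the common finite list; exponents
    outside the class contribute 0. *)
Lemma graded_H_trivial r :
  (forall m, in_class r m -> (exists i, negative m i) /\
     relative_exact C Sigma incident (negative m)) ->
  H_trivial_bundle Sigma v r.
Proof.
move=> Hr j c [cc dc]; have [S [d [uS dP]]] := cochain_expand cc.
have dd0 m s : cones_of Sigma s -> delta (fun s' => d s' m) s = 0.
  move=> Ss; have [mS|mS] := boolP (m \in S); last first.
    by rewrite /delta big1 // => k _; have [-> //] := dP _ (cones_of_lift k Ss); rewrite mulr0.
  apply: (monomial_free (c := fun m => delta (fun s' => d s' m) s) uS _ mS) => x x0.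
  rewrite -(cech_d_monomials (b := c)) ?dc //; first exact: chart_torus.
  move=> k; have [_ _ -> //] := dP _ (cones_of_lift k Ss).
  exact: chart_torus.
have /choice[b bP] : forall m, exists b : ('I_j -> set 'rV[R]_2) -> C,
    [/\ relative Sigma incident (negative m) b, ~ in_class r m -> b = fun=> 0 &
      forall s, cones_of Sigma s -> d s m = delta b s].
  move=> m; have [rm|nrm] := pselect (in_class r m).
    have [|b [rb db]] := (Hr m rm).2 j (fun s => d s m) _ (dd0 m).
      move=> s Ss /shareP ns; have [_ d_eff _] := dP s Ss.
      by apply/eqP; apply: contrapT => /negP /d_eff[] /ns.
    by exists b; split.
  exists (fun=> 0); split=> // s Ss; rewrite [RHS]big1 => [|k _]; last by rewrite mulr0.
  have [_ d_eff _] := dP s Ss.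
  by apply/eqP; apply: contrapT => /negP /d_eff[_].
case: j c cc dc d dP dd0 b bP => [|j] c cc dc d dP dd0 b bP.
  (* In degree 0 the primitive lives on the empty tuple, where it vanishes because [m] has a
     negative entry. *)
  move=> s Ss x Ux; have [_ _ ->//] := dP s Ss; rewrite big1 // => m _.
  have [rb nb ->//] := bP m; rewrite /delta big1 ?mul0r // => k _.
  have [rm|nrm] := pselect (in_class r m); last by rewrite nb // mulr0.
  have [[i mi] _] := Hr m rm.
  by rewrite rb ?mulr0 => [//|[]//|]; exists i => // -[].
exists (fun s x => \sum_(m <- S) b m s * monomial m x); split.
  move=> s Ss; apply: section_sum => m; have [rb nb _] := bP m.
  have [b0|b0] := eqVneq (b m s) 0.
    by rewrite b0; under eq_fun do rewrite mul0r; apply: section0.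
  have rm : in_class r m by apply: contrapT => /nb e; rewrite e eqxx in b0.
  apply: section_monomial => //; apply: contrapT => /shareP ns.
  by rewrite rb ?eqxx in b0.
move=> s Ss x Ux; rewrite (@cech_d_monomials _ S (fun s m => b m s)) //.
have [_ _ -> //] := dP s Ss; apply: eq_bigr => m _.
by have [_ _ ->] := bP m.
Qed.

End Graded.

(** * Sign patterns of functionals along the cycle *)

(** Used to impose the sign pattern of a functional off its zeros; the lower bound [l] lets the same
    multiple make a last coordinate nonnegative. *)
Lemma int_dominate n (F G : 'I_n -> int) (l : int) : exists2 N : int, l <= N &
  forall i, G i != 0 -> (F i + N * G i < 0) = (G i < 0).
Proof.
have [N N0 FN] := int_bound F; exists (N + `|l|); first lia.
move=> i Gi; have Fi := FN i.
have [G_lt|G_ge] := ltrP (G i) 0.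
  have : (N + `|l|) * G i <= - N by nia.
  by lia.
have : N <= (N + `|l|) * G i by nia.
by move=> h; apply/negbTE; rewrite -leNgt; lia.
Qed.

Section SignPatterns.
Variables (n : nat) (nx : 'I_n -> 'I_n) (v : 'I_n -> lattice).
Hypothesis nx_inj : injective nx.
Hypothesis nx_det : forall i, 0 < det2 (v i) (v (nx i)).
Hypothesis v_parallel : forall i j,
  det2 (v i) (v j) = 0 -> 0 < dot2 (v i) (v j) -> i = j.
Variables (r1 r2 : 'I_n -> int).

Definition one_arc (f : 'I_n -> int) : Prop :=
  [/\ exists i, f i < 0, exists i, 0 <= f i & ~ splits nx (fun i => f i < 0)].

(* The value of the functional (p, q, t) at the point (v i, r2 i) of Z^3. *)
Definition functional (p q t : int) (i : 'I_n) : int :=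
  p * v i 0 0 + q * v i 0 1 + t * r2 i.

Definition is_functional (F : 'I_n -> int) : Prop :=
  exists p q t, forall i, F i = functional p q t i.

Lemma functionalD F G : is_functional F -> is_functional G ->
  is_functional (fun i => F i + G i).
Proof.
move=> [p [q [t Ft]]] [p' [q' [t' Gt]]]; exists (p + p'), (q + q'), (t + t') => i.
by rewrite Ft Gt /functional; ring.
Qed.

Lemma functionalZ c F : is_functional F -> is_functional (fun i => c * F i).
Proof.
move=> [p [q [t Ft]]]; exists (c * p), (c * q), (c * t) => i.
by rewrite Ft /functional; ring.
Qed.

Lemma functionalN F : is_functional F -> is_functional (fun i => - F i).
Proof.
by move=> /(functionalZ (-1)) [p [q [t Ft]]]; exists p, q, t => i; rewrite -Ft mulN1r.
Qed.

(** The determinant with rows (v i, r2 i), (v j, r2 j), (v k, r2 k); it is a functional in each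
    index. *)
Definition det3 i j k : int :=
  v i 0 0 * (v j 0 1 * r2 k - r2 j * v k 0 1)
  - v i 0 1 * (v j 0 0 * r2 k - r2 j * v k 0 0)
  + r2 i * (v j 0 0 * v k 0 1 - v j 0 1 * v k 0 0).

Lemma det3_rot i j k : det3 i j k = det3 j k i.
Proof. by rewrite /det3; ring. Qed.

Lemma det3_iij i j : det3 i i j = 0. Proof. by rewrite /det3; ring. Qed.
Lemma det3_iji i j : det3 i j i = 0. Proof. by rewrite /det3; ring. Qed.
Lemma det3_ijj i j : det3 i j j = 0. Proof. by rewrite /det3; ring. Qed.

Lemma det3E j k i : det3 j k i =
  functional (v j 0 1 * r2 k - r2 j * v k 0 1) (r2 j * v k 0 0 - v j 0 0 * r2 k)
    (det2 (v j) (v k)) i.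
Proof. by rewrite /det3 /functional /det2; ring. Qed.

Lemma functional_det3 j k : is_functional (det3 j k).
Proof. by do 3!eexists; move=> i; exact: det3E. Qed.

Lemma functional_det3m j k : is_functional (fun i => det3 j i k).
Proof.
have [p [q [t H]]] := functional_det3 k j; exists p, q, t => i.
by rewrite -H det3_rot det3_rot.
Qed.

Lemma functional_det3l j k : is_functional (fun i => det3 i j k).
Proof.
have [p [q [t H]]] := functional_det3 j k; exists p, q, t => i.
by rewrite -H det3_rot.
Qed.

Lemma functional_det2 j : is_functional (fun i => det2 (v j) (v i)).
Proof. by exists (- v j 0 1), (v j 0 0), 0 => i; rewrite /functional /det2; ring. Qed.

Lemma functional_dot2 j : is_functional (fun i => dot2 (v j) (v i)).
Proof. by exists (v j 0 0), (v j 0 1), 0 => i; rewrite /functional /dot2; ring. Qed.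

Lemma nx_dot i : 0 < dot2 (v i) (v i).
Proof.
apply: dot2_gt0; apply/eqP => vi; have := nx_det i.
by rewrite vi /det2 !mxE !mul0r subrr ltxx.
Qed.

(** On the orbit of [i], [det2 (v i)] takes both signs, at [nx i] and at the predecessor of [i].
    With a second orbit, this functional or its negative would be negative somewhere on and
    somewhere off the orbit of [i], and membership in that orbit would split the negative set. *)
Lemma nsplits_connected :
  (forall p q, ~ splits nx (fun i => r1 i + functional p q 0 i < 0)) ->
  forall i j, fconnect nx i j.
Proof.
move=> r_ns i j; apply: contrapT => /negP nij.
have nx_conn k : fconnect nx i (nx k) = fconnect nx i k.
  by rewrite -same_fconnect1_r.
(* Of the independent vectors [v j] and [v (nx j)], at least one is not parallel to [v i]. *)
have [k nik ik] : exists2 k, ~~ fconnect nx i k & det2 (v i) (v k) != 0.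
  have [ij|ij] := eqVneq (det2 (v i) (v j)) 0; last by exists j.
  exists (nx j); rewrite ?nx_conn //; apply/eqP => inj.
  have jj := nx_det j; have ii := nx_dot i.
  have : dot2 (v i) (v i) * det2 (v j) (v (nx j)) = 0.
    have -> : dot2 (v i) (v i) * det2 (v j) (v (nx j)) =
       dot2 (v i) (v j) * det2 (v i) (v (nx j))
       - det2 (v i) (v j) * dot2 (v i) (v (nx j)) by rewrite /dot2 /det2; ring.
    by rewrite inj ij mulr0 mul0r subrr.
  by move/eqP; rewrite mulf_eq0 !gt_eqF.
have conflict p q k' : fconnect nx i k' ->
    functional p q 0 k < 0 -> functional p q 0 k' < 0 -> False.
  move=> ik' kn k'n.
  have [N _ NP] := int_dominate r1 (functional p q 0) 0.
  apply: (r_ns (N * p) (N * q)).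
  have sE m : r1 m + functional (N * p) (N * q) 0 m =
      r1 m + N * functional p q 0 m by rewrite /functional; ring.
  exists (fconnect nx i); split=> [||m _ _]; last by rewrite nx_conn.
    by exists k' => //; rewrite sE NP // lt_eqF.
  by exists k => //; rewrite sE NP // lt_eqF.
have pE m : functional (- v i 0 1) (v i 0 0) 0 m = det2 (v i) (v m).
  by rewrite /functional /det2; ring.
have nE m : functional (v i 0 1) (- v i 0 0) 0 m = - det2 (v i) (v m).
  by rewrite /functional /det2; ring.
have [ik_lt|ik_gt] := ltrP (det2 (v i) (v k)) 0.
  apply: (conflict (- v i 0 1) (v i 0 0) (finv nx i)); rewrite ?pE //; first exact: fconnect_finv.
  by rewrite det2C oppr_lt0 -{2}(f_finv nx_inj i).
apply: (conflict (v i 0 1) (- v i 0 0) (nx i)); rewrite ?nE ?oppr_lt0 //; first exact: fconnect1.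
by rewrite lt_def ik.
Qed.

Hypothesis nx_conn : forall i j, fconnect nx i j.

(** A cycle of length 1 or 2 contradicts the antisymmetry of [det2], which is positive on
    consecutive rays. *)
Lemma cycle_ge3 : 'I_n -> (2 < n)%N.
Proof.
move=> i; have n0 : (0 < n)%N := leq_ltn_trans (leq0n i) (ltn_ord i).
have nn k : k = n -> iter k nx i = i by move=> ->; exact: (cycle_iter_n nx_inj nx_conn).
rewrite ltnNge; apply/negP => n2.
have := nx_det i; have := nx_det (nx i).
have [n1|n1] := eqVneq 1%N n; first by rewrite [nx i](nn _ n1) det2xx ltxx.
rewrite [nx (nx i)](nn 2%N) ?[det2 (v i) _]det2C ?oppr_gt0; last by lia.
by move=> /ltW/le_gtF ->.
Qed.

Hypothesis r_arc : forall p q t : int, 0 <= t ->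
  one_arc (fun i => r1 i + functional p q t i).

(** Adding to [r1] a large multiple of a positive functional, or of its negative if the last
    coordinate is negative, would leave no negative entry, or only negative ones. *)
Lemma functional_not_pos F : is_functional F -> exists i, F i <= 0.
Proof.
move=> [p [q [t FE]]]; apply: contrapT => nF.
have F_gt i : 0 < F i by rewrite ltNge; apply/negP => Fi; apply: nF; exists i.
have F0 i : F i != 0 by rewrite gt_eqF.
have [t0|t0] := lerP 0 t.
  have [N N0 NP] := int_dominate r1 F 0.
  have [|[i iN] _ _] := @r_arc (N * p) (N * q) (N * t); first exact: mulr_ge0.
  move: iN; have -> : functional (N * p) (N * q) (N * t) i = N * F i.
    by rewrite FE /functional; ring.
  by rewrite NP // ltNge ltW.
have [N N0 NP] := int_dominate r1 (fun i => - F i) 0.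
have [|_ [i iN] _] := @r_arc (N * - p) (N * - q) (N * - t).
  by rewrite mulr_ge0 // oppr_ge0 ltW.
move: iN; have -> : functional (N * - p) (N * - q) (N * - t) i = N * - F i.
  by rewrite FE /functional; ring.
by rewrite leNgt NP ?oppr_lt0 ?F_gt // oppr_eq0.
Qed.

(** Negating the functional to make its last coordinate nonnegative reverses the alternation but
    keeps it, so [r1] plus a large multiple would alternate. *)
Lemma functional_alternate F i0 a b c d : is_functional F ->
  (a < b < c)%N -> (c < d < n)%N ->
  let e p := iter p nx i0 in
  F (e a) < 0 -> 0 < F (e b) -> F (e c) < 0 -> 0 < F (e d) -> False.
Proof.
move=> [p [q [t FE]]] abc cdn e Fa Fb Fc Fd.
have [t0|t0] := lerP 0 t.
  have [N N0 NP] := int_dominate r1 F 0.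
  have [|_ _] := @r_arc (N * p) (N * q) (N * t); first exact: mulr_ge0.
  apply; apply: (alternates_splits nx_inj nx_conn (i0 := i0)).
  have sE i : r1 i + functional (N * p) (N * q) (N * t) i = r1 i + N * F i.
    by rewrite FE /functional; ring.
  exists a, b, c, d; rewrite -/(e a) -/(e b) -/(e c) -/(e d) !sE.
  rewrite !NP ?(lt_eqF Fa) ?(gt_eqF Fb) ?(lt_eqF Fc) ?(gt_eqF Fd) //.
  by rewrite Fa Fc !ltNge !ltW.
have [N N0 NP] := int_dominate r1 (fun i => - F i) 0.
have [|_ _] := @r_arc (N * - p) (N * - q) (N * - t).
  by rewrite mulr_ge0 // oppr_ge0 ltW.
apply; apply: (alternates_splits nx_inj nx_conn (i0 := i0)).
have sE i : r1 i + functional (N * - p) (N * - q) (N * - t) i = r1 i + N * - F i.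
  by rewrite FE /functional; ring.
exists a, b, c, d; rewrite -/(e a) -/(e b) -/(e c) -/(e d) !sE.
rewrite !NP ?oppr_eq0 ?(lt_eqF Fa) ?(gt_eqF Fb) ?(lt_eqF Fc) ?(gt_eqF Fd) //.
by rewrite !oppr_lt0 Fb Fd !ltNge !ltW.
Qed.

Lemma functional_alternateN F i0 a b c d : is_functional F ->
  (a < b < c)%N -> (c < d < n)%N ->
  let e p := iter p nx i0 in
  0 < F (e a) -> F (e b) < 0 -> 0 < F (e c) -> F (e d) < 0 -> False.
Proof.
move=> /functionalN linF abc cdn e Fa Fb Fc Fd.
apply: (functional_alternate linF abc cdn (i0 := i0));
  by rewrite /= ?oppr_lt0 ?oppr_gt0.
Qed.

Lemma one_arc_ext f g : (forall i, f i = g i) -> one_arc f -> one_arc g.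
Proof. by move=> fg; have -> : f = g by apply: funext. Qed.

(** All points lie in the plane of the first two. The functional cutting out this plane has positive
    last coordinate, so adding a multiple raises [l] to a nonnegative value and changes no entry. *)
Lemma coplanar_one_arc (i0 : 'I_n) :
  (forall i, det3 i (nx i) (nx (nx i)) = 0) ->
  forall p q l, one_arc (fun i => r1 i + functional p q l i).
Proof.
move=> cop p q l.
pose psi := det3 i0 (nx i0).
have psi0 k : psi (iter k nx i0) = 0 /\ psi (iter k.+1 nx i0) = 0.
  elim: k => [|k [IH0 IH1]]; first by rewrite /psi /= det3_iji det3_ijj.
  split=> //; set a := iter k nx i0 in IH0 IH1 *.
  have [p' [q' [t psiE]]] := functional_det3 i0 (nx i0).
  have : det2 (v a) (v (nx a)) * psi (nx (nx a)) =
      det2 (v (nx (nx a))) (v (nx a)) * psi a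
      + det2 (v a) (v (nx (nx a))) * psi (nx a)
      + t * det3 a (nx a) (nx (nx a)).
    by rewrite /psi !psiE /functional /det3 /det2; ring.
  rewrite cop [psi (nx a)]IH1 IH0 !mulr0 !addr0 => /eqP.
  by rewrite mulf_eq0 gt_eqF //= => /eqP.
have {}psi0 i : psi i = 0.
  by have [k _ <-] := cycle_iter_ex nx_conn i0 i; case: (psi0 k).
have [p' [q' [t t0 psiE]]] : exists p' q', exists2 t, 0 < t &
    forall i, functional p' q' t i = 0.
  by do 2!eexists; exists (det2 (v i0) (v (nx i0))) => // i;
    exact: etrans (esym (det3E _ _ _)) (psi0 i).
have l0 : 0 <= l + `|l| * t by nia.
apply: one_arc_ext (r_arc (p + `|l| * p') (q + `|l| * q') l0) => i.
have -> : functional (p + `|l| * p') (q + `|l| * q') (l + `|l| * t) i =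
    functional p q l i + `|l| * functional p' q' t i by rewrite /functional; ring.
by rewrite psiE mulr0 addr0.
Qed.

(** * A corner: three consecutive points of Z^3 that are linearly independent *)

Section Corner.
Variable b : 'I_n.
Let e p := iter p nx b.
Let c := e 1.
Let a := e n.-1.
Hypothesis corner : det3 a b c != 0.

Let n3 : (2 < n)%N := cycle_ge3 b.
Let en : e n = b := cycle_iter_n nx_inj nx_conn b.
Let nxa : nx a = b.
Proof. by rewrite -en /a /e -iterS prednK //; lia. Qed.

Let e_inj p q : (p < n)%N -> (q < n)%N -> e p = e q -> p = q.
Proof. exact: (cycle_iter_inj nx_conn). Qed.

Lemma cramer3 F i : is_functional F -> det3 a b c * F i =
  det3 i b c * F a + det3 a i c * F b + det3 a b i * F c.
Proof. by move=> [p [q [t FE]]]; rewrite !FE /functional /det3; ring. Qed.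

Let sqr_corner : 0 < det3 a b c * det3 a b c.
Proof. by rewrite -expr2 exprn_even_gt0. Qed.

(* Otherwise some functional has the signs +, -, + on a, b, c and is negative
   at e d. *)
Lemma corner_outer_ge0 d : (1 < d < n.-1)%N ->
  0 <= det3 a b c * det3 (e d) b c /\ 0 <= det3 a b c * det3 a b (e d).
Proof.
move=> dn; set D := det3 a b c.
have D2 : 0 < D * D := sqr_corner.
have dn1 : (0 < 1 < d)%N by lia.
have dn2 : (d < n.-1 < n)%N by lia.
split; rewrite leNgt; apply/negP => neg.
  set M := 1 + `|D * (det3 a b (e d) - det3 a (e d) c)|.
  pose F i := D * (M * det3 i b c + (det3 a b i - det3 a i c)).
  have linF : is_functional F.
    apply: functionalZ; apply: functionalD; last apply: functionalD.
    - exact: functionalZ (functional_det3l _ _).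
    - exact: functional_det3.
    - exact: functionalN (functional_det3m _ _).
  have M1 : 1 <= M by rewrite lerDl.
  apply: (functional_alternate linF (i0 := b) dn1 dn2).
  - rewrite /F /= det3_iij det3_ijj -/D; lia.
  - rewrite /F -/(e 1) -/c det3_iji det3_ijj -/D; lia.
  - have -> : F (e d) = M * (D * det3 (e d) b c)
        + D * (det3 a b (e d) - det3 a (e d) c) by rewrite /F; ring.
    by rewrite /M; nia.
  - rewrite /F -/(e n.-1) -/a det3_iij det3_iji -/D; nia.
set M := 1 + `|D * (det3 (e d) b c - det3 a (e d) c)|.
pose F i := D * (M * det3 a b i + (det3 i b c - det3 a i c)).
have linF : is_functional F.
  apply: functionalZ; apply: functionalD; last apply: functionalD.
  - exact: functionalZ (functional_det3 _ _).
  - exact: functional_det3l.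
  - exact: functionalN (functional_det3m _ _).
have M1 : 1 <= M by rewrite lerDl.
apply: (functional_alternate linF (i0 := b) dn1 dn2).
- rewrite /F /= det3_iij det3_ijj -/D; lia.
- rewrite /F -/(e 1) -/c det3_iji det3_ijj -/D; nia.
- have -> : F (e d) = M * (D * det3 a b (e d))
      + D * (det3 (e d) b c - det3 a (e d) c) by rewrite /F; ring.
  by rewrite /M; nia.
- rewrite /F -/(e n.-1) -/a det3_iij det3_iji -/D; lia.
Qed.

(* If no e k is antipodal to b, the functional taking the values M, 1, M on
   a, b, c is positive everywhere for M large. *)
Lemma corner_antipode : exists2 k, (1 < k < n.-1)%N &
  det3 (e k) b c = 0 /\ det3 a b (e k) = 0.
Proof.
set D := det3 a b c; have D2 : 0 < D * D := sqr_corner.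
apply: contrapT => nk.
have [M M0 MP] := int_bound (fun i => D * det3 a i c).
pose F i := D * (M * det3 i b c + (det3 a i c + M * det3 a b i)).
have linF : is_functional F.
  apply: functionalZ; apply: functionalD; last apply: functionalD.
  - exact: functionalZ (functional_det3l _ _).
  - exact: functional_det3m.
  - exact: functionalZ (functional_det3 _ _).
have [i Fi] := functional_not_pos linF; move: Fi; apply/negP; rewrite -ltNge.
have [x xn <-] := cycle_iter_ex nx_conn b i; rewrite -/(e x).
have [->|x0] := eqVneq x 0%N; first by rewrite /F /= det3_iij det3_ijj -/D; lia.
have [->|x1] := eqVneq x 1%N.
  by rewrite /F -/c det3_iji det3_ijj -/D; nia.
have [->|xn1] := eqVneq x n.-1.
  by rewrite /F -/a det3_iij det3_iji -/D; nia.
have xr : (1 < x < n.-1)%N by lia.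
have [al ga] := corner_outer_ge0 xr; rewrite -/D in al ga.
have xM := MP (e x).
have -> : F (e x) = M * (D * det3 (e x) b c + D * det3 a b (e x))
  + D * det3 a (e x) c by rewrite /F; ring.
(* Both summands are nonnegative integers; if both were 0, the point of [e x] would be a multiple of
   that of [b]. *)
suff : 1 <= D * det3 (e x) b c + D * det3 a b (e x) by nia.
rewrite leNgt; apply/negP => lt1; apply: nk; exists x => //.
have D0 : D != 0 := corner.
have [al0 ga0] : D * det3 (e x) b c = 0 /\ D * det3 a b (e x) = 0 by lia.
split; apply/eqP.
  by move/eqP: al0; rewrite mulf_eq0 (negbTE D0).
by move/eqP: ga0; rewrite mulf_eq0 (negbTE D0).
Qed.

(** * The two half-planes bounded by the line of an antipodal pair *)

Section Antipode.
Variable k : nat.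
Hypothesis k_range : (1 < k < n.-1)%N.
Hypothesis k_al : det3 (e k) b c = 0.
Hypothesis k_ga : det3 a b (e k) = 0.

(** By Cramer's rule the point of [e k] is a multiple of that of [b]. The factor is negative because
    distinct parallel rays point in opposite directions. *)
Lemma antipode_scale : exists x y : int, [/\ 0 < x, y < 0 &
  forall F, is_functional F -> x * F (e k) = y * F b].
Proof.
set D := det3 a b c; have D2 : 0 < D * D := sqr_corner.
have D0 : D != 0 := corner.
pose be := det3 a (e k) c.
have kE F : is_functional F -> D * F (e k) = be * F b.
  by move=> linF; rewrite (cramer3 _ linF) k_al k_ga !mul0r add0r addr0.
exists (D * D), (D * be); split=> //; last first.
  by move=> F linF; rewrite -!mulrA kE.
have bb := nx_dot b; have kk := nx_dot (e k).
have bk : det2 (v b) (v (e k)) = 0.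
  apply/eqP; have /eqP := kE _ (functional_det2 b).
  by rewrite det2xx mulr0 mulf_eq0 (negbTE D0).
have dk := kE _ (functional_dot2 b).
have dk_le : dot2 (v b) (v (e k)) <= 0.
  rewrite leNgt; apply/negP => /(v_parallel bk) bek.
  have : 0%N = k by apply: e_inj => //; lia.
  by lia.
have dk0 : dot2 (v b) (v (e k)) != 0.
  apply/eqP => dk0; have := det2_dot2 (v b) (v (e k)).
  by rewrite bk dk0 expr0n addr0 => /eqP; rewrite mulf_eq0 !gt_eqF.
have dk_lt : dot2 (v b) (v (e k)) < 0 by rewrite lt_neqAle dk0.
rewrite -(pmulr_llt0 _ bb) -mulrA -dk mulrA.
by rewrite pmulr_rlt0.
Qed.

Lemma antipode_gt0 F : is_functional F -> F b < 0 -> 0 < F (e k).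
Proof.
have [x [y [x0 y0 xy]]] := antipode_scale.
by move=> /xy e_xy Fb; rewrite -(pmulr_rgt0 _ x0) e_xy nmulr_rgt0.
Qed.

Lemma antipode_lt0 F : is_functional F -> 0 < F b -> F (e k) < 0.
Proof.
have [x [y [x0 y0 xy]]] := antipode_scale.
by move=> /xy e_xy Fb; rewrite -(pmulr_rlt0 _ x0) e_xy nmulr_rlt0.
Qed.

Lemma antipode_eq0 F : is_functional F -> F b = 0 -> F (e k) = 0.
Proof.
have [x [y [x0 y0 xy]]] := antipode_scale.
move=> /xy e_xy Fb; move/eqP: e_xy; rewrite Fb mulr0 mulf_eq0 gt_eqF //=.
by move/eqP.
Qed.

(** If the points of [b], [c], [e x] were independent, some functional would have signs +, -, +
    there; antipodality makes it negative at [e k], giving a forbidden alternation. *)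
Lemma det3_forward x : (x <= k)%N -> det3 b c (e x) = 0.
Proof.
move=> xk; have [->|x0] := eqVneq x 0%N; first by rewrite /e /= det3_iji.
have [->|x1] := eqVneq x 1%N; first by rewrite -/c det3_ijj.
have [->|xk'] := eqVneq x k.
  by apply: antipode_eq0 (functional_det3 _ _) _; rewrite det3_iji.
apply/eqP; apply: contrapT => /negP; set D := det3 _ _ _ => D0.
have D2 : 0 < D * D by rewrite -expr2 exprn_even_gt0.
pose F i := D * (det3 i c (e x) + (det3 b c i - det3 b i (e x))).
have linF : is_functional F.
  apply: functionalZ; apply: functionalD; last apply: functionalD.
  - exact: functional_det3l.
  - exact: functional_det3.
  - exact: functionalN (functional_det3m _ _).
have Fb : 0 < F b by rewrite /F det3_iji det3_iij -/D; lia.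
have x01 : (0 < 1 < x)%N by lia.
have xkn : (x < k < n)%N by lia.
apply: (functional_alternateN linF (i0 := b) x01 xkn) => //.
- by rewrite /F -/(e 1) -/c det3_iij det3_ijj -/D; lia.
- by rewrite /F -/(e x) det3_iji det3_ijj -/D; lia.
- exact: antipode_lt0.
Qed.

(** Mirror image of [det3_forward], alternating at [b], [e k], [e x], [a]. *)
Lemma det3_backward x : (k <= x < n)%N -> det3 a b (e x) = 0.
Proof.
move=> kx; have [->|xn] := eqVneq x n.-1; first by rewrite -/a det3_iji.
have [->//|xk'] := eqVneq x k.
apply/eqP; apply: contrapT => /negP; set D := det3 _ _ _ => D0.
have D2 : 0 < D * D by rewrite -expr2 exprn_even_gt0.
pose F i := D * (det3 a b i + (det3 a i (e x) - det3 i b (e x))).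
have linF : is_functional F.
  apply: functionalZ; apply: functionalD; last apply: functionalD.
  - exact: functional_det3.
  - exact: functional_det3m.
  - exact: functionalN (functional_det3l _ _).
have Fb : 0 < F b by rewrite /F det3_iij det3_ijj -/D; lia.
have x01 : (0 < k < x)%N by lia.
have xkn : (x < n.-1 < n)%N by lia.
apply: (functional_alternateN linF (i0 := b) x01 xkn) => //.
- exact: antipode_lt0.
- by rewrite /F -/(e x) det3_iji det3_ijj -/D; lia.
- by rewrite /F -/(e n.-1) -/a det3_iji det3_iij -/D; lia.
Qed.

Lemma det2_antipode : det2 (v b) (v (e k)) = 0.
Proof. by apply: antipode_eq0 (functional_det2 _) _; rewrite det2xx. Qed.

Lemma dot2_antipode : dot2 (v b) (v (e k)) < 0.
Proof. by apply: antipode_lt0 (functional_dot2 _) _; exact: nx_dot. Qed.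

(** A ray other than [b] on the line of [v b] points opposite to [v b], as [v (e k)] does, and so
    equals [e k]. *)
Lemma det2_neq0 x : (0 < x < n)%N -> x != k -> det2 (v b) (v (e x)) != 0.
Proof.
move=> xn xk; apply/eqP => bx; have bb := nx_dot b; have xx := nx_dot (e x).
have dx_le : dot2 (v b) (v (e x)) <= 0.
  rewrite leNgt; apply/negP => /(v_parallel bx) bex.
  have : 0%N = x by apply: e_inj => //; lia.
  by lia.
have dx0 : dot2 (v b) (v (e x)) != 0.
  apply/eqP => dx0; have := det2_dot2 (v b) (v (e x)).
  by rewrite bx dx0 expr0n addr0 => /eqP; rewrite mulf_eq0 !gt_eqF.
have dx_lt : dot2 (v b) (v (e x)) < 0 by rewrite lt_neqAle dx0.
have bk := det2_antipode; have dk := dot2_antipode.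
suff /v_parallel ekx : det2 (v (e k)) (v (e x)) = 0.
  case/eqP: xk; apply: e_inj; [lia | lia | apply/esym/ekx].
  rewrite -(pmulr_rgt0 _ bb).
  have -> : dot2 (v b) (v b) * dot2 (v (e k)) (v (e x)) =
      dot2 (v b) (v (e k)) * dot2 (v b) (v (e x))
      + det2 (v b) (v (e k)) * det2 (v b) (v (e x)) by rewrite /dot2 /det2; ring.
  by rewrite bx mulr0 addr0 nmulr_rgt0.
apply/eqP; have : dot2 (v b) (v b) * det2 (v (e k)) (v (e x)) == 0.
  have -> : dot2 (v b) (v b) * det2 (v (e k)) (v (e x)) =
      dot2 (v b) (v (e k)) * det2 (v b) (v (e x))
      - det2 (v b) (v (e k)) * dot2 (v b) (v (e x)) by rewrite /dot2 /det2; ring.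
  by rewrite bx bk mulr0 mul0r subrr.
by rewrite mulf_eq0 gt_eqF.
Qed.

(** Were [v (e x)] on the wrong side of the line, a slight tilt of [det2 (v b)] would have signs -,
    +, -, + at [b], [c], [e x], [e k]. *)
Lemma det2_forward x : (0 < x < k)%N -> 0 < det2 (v b) (v (e x)).
Proof.
move=> xk; rewrite lt_def det2_neq0 //=; try lia.
rewrite leNgt; apply/negP => bx.
have c0 : 0 < det2 (v b) (v c) by exact: nx_det.
have [x1|x1] := eqVneq x 1%N; first by move: bx; rewrite x1 -/c ltNge ltW.
set M := 1 + `|dot2 (v b) (v c)| + `|dot2 (v b) (v (e x))|.
pose F i := M * det2 (v b) (v i) - dot2 (v b) (v i).
have linF : is_functional F.
  apply: functionalD; first exact: functionalZ (functional_det2 _).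
  exact: functionalN (functional_dot2 _).
have Fb : F b < 0 by rewrite /F det2xx mulr0 sub0r oppr_lt0; exact: nx_dot.
have x01 : (0 < 1 < x)%N by lia.
have xkn : (x < k < n)%N by lia.
apply: (functional_alternate linF (i0 := b) x01 xkn) => //.
- by rewrite /F -/(e 1) -/c /M; nia.
- by rewrite /F -/(e x) /M; nia.
- exact: antipode_gt0.
Qed.

(** Mirror image of [det2_forward], with signs +, -, +, - at [b], [e k], [e x], [a]. *)
Lemma det2_backward x : (k < x < n)%N -> det2 (v b) (v (e x)) < 0.
Proof.
move=> kx; rewrite lt_neqAle det2_neq0 //=; try lia.
rewrite leNgt; apply/negP => bx.
have a0 : det2 (v b) (v a) < 0.
  by rewrite det2C oppr_lt0 -[in X in det2 _ X]nxa; exact: nx_det.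
have [x1|x1] := eqVneq x n.-1; first by move: bx; rewrite x1 -/a ltNge ltW.
set M := 1 + `|dot2 (v b) (v a)| + `|dot2 (v b) (v (e x))|.
pose F i := M * det2 (v b) (v i) + dot2 (v b) (v i).
have linF : is_functional F.
  apply: functionalD; first exact: functionalZ (functional_det2 _).
  exact: functional_dot2.
have Fb : 0 < F b by rewrite /F det2xx mulr0 add0r; exact: nx_dot.
have x01 : (0 < k < x)%N by lia.
have xkn : (x < n.-1 < n)%N by lia.
apply: (functional_alternateN linF (i0 := b) x01 xkn) => //.
- exact: antipode_lt0.
- by rewrite /F -/(e x) /M; nia.
- by rewrite /F -/(e n.-1) -/a /M; nia.
Qed.

(** On the backward half [det3 a b] vanishes, so this relation yields the sign of [det3 b c]
    there. *)
Lemma det3_plucker i : det2 (v a) (v b) * det3 b c i + det3 a b c * det2 (v b) (v i)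
  = det2 (v b) (v c) * det3 a b i.
Proof. by rewrite /det3 /det2; ring. Qed.

Let sign_eq (t u y : int) : 0 < t -> 0 < y -> t * u = det3 a b c * y ->
  u != 0 /\ (u < 0) = (det3 a b c < 0).
Proof.
move=> t0 y0 tu; rewrite -(pmulr_rlt0 _ t0) tu pmulr_llt0 //; split=> //.
apply/eqP => u0; move/esym/eqP: tu.
by rewrite u0 mulr0 mulf_eq0 (negbTE corner) gt_eqF.
Qed.

Lemma det3_backward_sign x : (k < x < n)%N ->
  det3 b c (e x) != 0 /\ (det3 b c (e x) < 0) = (det3 a b c < 0).
Proof.
move=> kx; have ab : 0 < det2 (v a) (v b) by rewrite -nxa; exact: nx_det.
apply: (@sign_eq _ _ (- det2 (v b) (v (e x))) ab).
  by rewrite oppr_gt0 det2_backward.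
have := det3_plucker (e x); rewrite (@det3_backward x) ?mulr0; last by lia.
by move/eqP; rewrite addr_eq0 mulrN => /eqP.
Qed.

(** A large multiple of [det3 b c], which vanishes at positions 0 to [k], or of [det3 a b], which
    vanishes at 0 and from [k] on, makes the last coordinate nonnegative and keeps the signs of [f]
    on that half. The hypothesis then yields opposite signs at [b] and [e k] and a single sign
    change on each half. *)
Lemma lune_one_arc p q l : one_arc (fun i => r1 i + functional p q l i).
Proof.
pose f i := r1 i + functional p q l i.
pose E := det3 a b c < 0.
have ab : 0 < det2 (v a) (v b) by rewrite -nxa; exact: nx_det.
have bc : 0 < det2 (v b) (v c) by exact: nx_det.
(* The last coordinates of [det3 b c] and [det3 a b] are the positive numbers in the condition; that
   of [det2 (v b)] is 0, so [M] is free. *)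
have shift N M N' : 0 <= l + N * det2 (v b) (v c) + N' * det2 (v a) (v b) ->
    one_arc (fun i => f i + M * det2 (v b) (v i) + N * det3 b c i + N' * det3 a b i).
  move=> l0.
  apply: one_arc_ext (r_arc
    (p - M * v b 0 1 + N * (v b 0 1 * r2 c - r2 b * v c 0 1)
       + N' * (v a 0 1 * r2 b - r2 a * v b 0 1))
    (q + M * v b 0 0 + N * (r2 b * v c 0 0 - v b 0 0 * r2 c)
       + N' * (r2 a * v b 0 0 - v a 0 0 * r2 b)) l0) => i.
  by rewrite /f !det3E /functional /det2; ring.
pose s x := f (e x) < 0.
have det3_k : det3 b c (e k) = 0 by exact: det3_forward.
have det3_0 : det3 b c (e 0) = 0 by exact: det3_forward.
have det3_0' : det3 a b (e 0) = 0 by rewrite det3_ijj.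
have splitsP (g : 'I_n -> int) w x y z : one_arc g -> (w < x < y)%N -> (y < z < n)%N ->
    (g (e x) < 0) = ~~ (g (e w) < 0) -> (g (e y) < 0) = (g (e w) < 0) ->
    (g (e z) < 0) = ~~ (g (e w) < 0) -> False.
  move=> [_ _ ns] wxy yzn gx gy gz; apply: ns.
  apply: (alternates_splits nx_inj nx_conn (i0 := b)).
  by exists w, x, y, z.
have range x : (x < n)%N -> [\/ x = 0%N, (0 < x < k)%N, x = k | (k < x < n)%N].
  move=> xn; have [->|x0] := eqVneq x 0%N; first by constructor 1.
  have [->|xk] := eqVneq x k; first by constructor 3.
  have [xk'|xk'] := ltnP x k; [constructor 2; lia | constructor 4; lia].
have s0k : s k = ~~ s 0%N.
  have [//|sk] : s k = ~~ s 0%N \/ s k = s 0%N.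
    by case: (s k); case: (s 0%N); [right | left | left | right].
  (* A suitable shift of f keeps the signs at 0 and k and has the sign of
     [det3 a b c] at all other positions. *)
  exfalso; pose G i := if E then - det2 (v b) (v i) else det2 (v b) (v i).
  have [M _ MP] := int_dominate f G 0.
  pose M' := if E then - M else M.
  have GE i : f i + M' * det2 (v b) (v i) = f i + M * G i.
    by rewrite /M' /G; case: (E); rewrite ?mulrN ?mulNr.
  have [N Nl NP] := int_dominate (fun i => f i + M * G i) (det3 b c) `|l|.
  have l0 : 0 <= l + N * det2 (v b) (v c) + 0 * det2 (v a) (v b) by nia.
  have := shift N M' 0 l0; set h := fun i => _ => arc.
  have hE i : h i = f i + M * G i + N * det3 b c i by rewrite /h GE mul0r addr0.
  have h0 : (h (e 0) < 0) = s 0%N.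
    by rewrite hE det3_0 /G det2xx oppr0 if_same !mulr0 !addr0.
  have hk : (h (e k) < 0) = s 0%N.
    by rewrite hE det3_k /G det2_antipode oppr0 if_same !mulr0 !addr0.
  have hf x : (0 < x < k)%N -> (h (e x) < 0) = E.
    move=> xk; rewrite hE (@det3_forward x) ?mulr0 ?addr0; last by lia.
    have bx := det2_forward xk; have Gx : G (e x) != 0.
      by rewrite /G; case: (E); rewrite ?oppr_eq0 gt_eqF.
    rewrite MP // /G; case: (E); first by rewrite oppr_lt0.
    by apply/negbTE; rewrite -leNgt ltW.
  have hb x : (k < x < n)%N -> (h (e x) < 0) = E.
    by move=> kx; have [d0 d_lt] := det3_backward_sign kx; rewrite hE NP.
  (* If this common sign agrees with the one at 0 and [k], then [h] has constant sign; otherwise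
     positions 0, 1, [k], [n.-1] alternate. *)
  have [s0E|s0E] := eqVneq (s 0%N) E.
    have hall i : (h i < 0) = E.
      have [x xn <-] := cycle_iter_ex nx_conn b i; rewrite -/(e x).
      by case: (range x xn) => [->|/hf//|->|/hb//]; rewrite ?h0 ?hk.
    case: arc => -[i hi] [j hj] _; move: hj; rewrite leNgt hall.
    by rewrite -(hall i) hi.
  by apply: (splitsP _ 0%N 1%N k n.-1 arc);
    rewrite ?h0 ?hk ?(hf 1%N) ?(hb n.-1) //; try lia; case: (s 0%N) s0E; case: (E).
have forward x y : (0 < x < y)%N -> (y < k)%N -> s x = ~~ s 0%N -> s y = s 0%N -> False.
  move=> xy yk sx sy.
  have [N Nl NP] := int_dominate f (det3 b c) `|l|.
  have l0 : 0 <= l + N * det2 (v b) (v c) + 0 * det2 (v a) (v b) by nia.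
  have hE z : (z <= k)%N -> (f (e z) + 0 * det2 (v b) (v (e z)) + N * det3 b c (e z)
      + 0 * det3 a b (e z) < 0) = s z.
    by move=> zk; rewrite (@det3_forward z) // mulr0 !mul0r !addr0.
  by apply: (splitsP _ 0%N x y k (shift N 0 0 l0)); rewrite ?hE //; lia.
have backward x y : (k < x < y)%N -> (y < n)%N -> s x = s 0%N -> s y = ~~ s 0%N -> False.
  move=> xy yk sx sy.
  have [N Nl NP] := int_dominate f (det3 a b) `|l|.
  have l0 : 0 <= l + 0 * det2 (v b) (v c) + N * det2 (v a) (v b) by nia.
  have hE z : (z == 0%N) || (k <= z < n)%N ->
      (f (e z) + 0 * det2 (v b) (v (e z)) + 0 * det3 b c (e z)
      + N * det3 a b (e z) < 0) = s z.
    move=> /predU1P[->|zk]; first by rewrite det3_0' mulr0 !mul0r !addr0.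
    by rewrite (@det3_backward z) // mulr0 !mul0r !addr0.
  by apply: (splitsP _ 0%N k x y (shift 0 0 N l0)); rewrite ?hE //; lia.
split.
- have [s0|s0] := boolP (s 0%N); first by exists (e 0).
  by exists (e k); rewrite -/(f _) -/(s k) s0k s0.
- have [s0|s0] := boolP (s 0%N); last by exists (e 0); rewrite leNgt.
  by exists (e k); rewrite leNgt -/(f _) -/(s k) s0k s0.
move=> /(splits_alternates nx_inj nx_conn b) [w [x [y [z [wxy yzn]]]]].
rewrite -/(s w) -/(s x) -/(s y) -/(s z) => sx sy sz.
(* One of the inner positions [x], [y] has the sign of position 0, hence is not [k]; on whichever
   half it lies, it and a neighbour in the list contradict [forward] or [backward]. *)
have [sw|sw] : s w = s 0%N \/ s w = ~~ s 0%N.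
- by case: (s w); case: (s 0%N); [left | right | right | left].
- rewrite sw in sx sy sz.
  have yk : y != k by apply: contra_eq_neq sy => ->; rewrite s0k; case: (s 0%N).
  have [y_lt|y_ge] := ltnP y k; first by apply: (forward x y); rewrite ?sx; lia.
  by apply: (backward y z); rewrite ?sy ?sz //; lia.
rewrite sw negbK in sx sy sz.
have xk : x != k by apply: contra_eq_neq sx => ->; rewrite s0k; case: (s 0%N).
have w0 : w != 0%N by apply: contra_eq_neq sw => ->; case: (s 0%N).
have [x_lt|x_ge] := ltnP x k; first by apply: (forward w x); rewrite ?sx //; lia.
by apply: (backward x y); rewrite ?sx ?sy //; lia.
Qed.

End Antipode.
End Corner.

Theorem one_arc_all p q l : one_arc (fun i => r1 i + functional p q l i).
Proof.
have [cop|] := pselect (forall i, det3 i (nx i) (nx (nx i)) = 0).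
  have [[i _] _ _] := @r_arc 0 0 0 (lexx 0).
  exact: coplanar_one_arc i cop p q l.
move=> /existsNP[i /eqP corner].
(* The corner is based at its middle ray [nx i], whose predecessor is reached after [n.-1] steps. *)
have ai : iter n.-1 nx (nx i) = i.
  have n0 : (0 < n)%N := leq_ltn_trans (leq0n i) (ltn_ord i).
  apply: nx_inj; rewrite -iterS prednK //.
  exact: (cycle_iter_n nx_inj nx_conn).
have corner' : det3 (iter n.-1 nx (nx i)) (nx i) (iter 1 nx (nx i)) != 0.
  by rewrite ai.
have [k k_range [k_al k_ga]] := corner_antipode corner'.
exact: (lune_one_arc corner' k_range k_al k_ga).
Qed.

End SignPatterns.

(** * H-triviality in terms of sign patterns *)

Lemma Pic_classDMz n (v : 'I_n -> lattice) (r s : 'rV[int]_n) (l : int) :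
  Pic_class v (r + s *~ l) = Pic_class v r + Pic_class v s *~ l.
Proof.
rewrite /Pic_class (raddfD (\pi_(Quotient.quot (trivial_divisor v)))).
by rewrite (raddfMz (\pi_(Quotient.quot (trivial_divisor v)))).
Qed.

Section HTrivialArcs.
Variables (R : realType) (n : nat) (Sigma : set (set 'rV[R]_2)).
Variables (v : 'I_n -> lattice).
Hypothesis hSigma : complete_stacky_fan Sigma v.
Variable nx : 'I_n -> 'I_n.
Hypothesis nx_inj : injective nx.
Hypothesis nx_det : forall i, 0 < det2 (v i) (v (nx i)).
Hypothesis nx_cone : forall i, exists2 sigma, Sigma sigma &
  forall k, incident v sigma k <-> k = i \/ k = nx i.
Hypothesis cone_le2 : forall sigma j, Sigma sigma -> incident v sigma j ->
  exists i, forall k, incident v sigma k -> k = i \/ k = nx i.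

(** Kept separate because connectedness of [nx] is deduced from it in the final proof. *)
Lemma H_trivial_nsplits r m : H_trivial_bundle Sigma v r -> in_class v r m ->
  ~ splits nx (negative m).
Proof.
move=> Hr rm; have Sfin := fan_finite (stacky_fan hSigma).
exact: (relative_exact_nsplits nx_cone cone_le2 (H_trivial_graded Sfin Hr rm)).
Qed.

Lemma H_trivial_one_arc r : (forall i j, fconnect nx i j) ->
  H_trivial_bundle Sigma v r <->
  forall m, in_class v r m -> one_arc nx (fun i => m 0 i).
Proof.
move=> nx_conn; have Sfin := fan_finite (stacky_fan hSigma).
have Sn0 : Sigma !=set0.
  by have [sigma Ss _] := stacky_complete hSigma 0; exists sigma.
split=> [Hr m rm|arcs].
  have [i mi] := H_trivial_negative Sn0 Hr rm.
  split; [by exists i | | exact: H_trivial_nsplits Hr rm].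
  apply: contrapT => npos.
  apply: (relative_nexactT nx_cone cone_le2 nx_inj nx_conn _ _
    (H_trivial_graded Sfin Hr rm)); first exact: (cycle_ge3 nx_inj nx_det nx_conn i).
  by move=> j; rewrite /negative ltNge; apply/negP => mj; apply: npos; exists j.
apply: graded_H_trivial => // m /arcs[neg [i pos] ns]; split=> //.
apply: (relative_exact_nsplit nx_cone cone_le2 nx_inj nx_conn) => //.
by exists i; rewrite /negative -leNgt.
Qed.

End HTrivialArcs.

Theorem proposition4p6 (R : realType) (n : nat)
  (Sigma : set (set 'rV[R]_2)) (v : 'I_n -> lattice)
  (hSigma : complete_stacky_fan Sigma v) (D1 D2 : Pic v)
  (hD : forall l : int, 0 <= l -> H_trivial Sigma (D1 + D2 *~ l)) :
  forall l : int, H_trivial Sigma (D1 + D2 *~ l).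
Proof.
have [nx [nx_inj nx_det nx_cone cone_le2]] := stacky_cycle hSigma.
set r1 := Pic_repr D1; set r2 := Pic_repr D2.
have DE l : D1 + D2 *~ l = Pic_class v (r1 + r2 *~ l).
  by rewrite Pic_classDMz /Pic_class !reprK.
have {}hD l : 0 <= l -> H_trivial_bundle Sigma v (r1 + r2 *~ l).
  by move=> /hD; rewrite DE H_trivial_class.
move=> l; rewrite DE H_trivial_class.
(* As [p] and [q] vary, the rows [F p q t] run through the class of [r1 + r2 *~ t]. *)
pose F p q t i := r1 0 i + functional v (r2 0) p q t i.
have FE (w : dual_lattice) t :
    r1 + r2 *~ t + char_divisor v w = \row_i F (w 0 0) (w 1 0) t i.
  apply/rowP => i; rewrite -scaler_int intz !mxE /pairing mxE.
  rewrite !big_ord_recl big_ord0 /F /functional.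
  have -> : lift ord0 ord0 = 1 :> 'I_2 by apply: val_inj.
  ring.
have F_class p q t : in_class v (r1 + r2 *~ t) (\row_i F p q t i).
  exists (\col_j if j == 0 then p else q).
  by rewrite FE !mxE.
have rowE f : (fun i => (\row_i f i) 0 i) = f :> ('I_n -> int).
  by apply: funext => i; rewrite mxE.
(* H-triviality at [l = 0] already forces a single cycle. *)
have nx_conn i j : fconnect nx i j.
  apply: (nsplits_connected nx_inj nx_det (r1 := r1 0) (r2 := r2 0)) => p q.
  have := H_trivial_nsplits hSigma nx_cone cone_le2 (hD 0 (lexx 0)) (F_class p q 0).
  by rewrite /negative; under eq_fun do rewrite mxE.
have arcP r := H_trivial_one_arc hSigma nx_inj nx_det nx_cone cone_le2 r nx_conn.
apply/arcP => m [w ->]; rewrite FE rowE.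
apply: (one_arc_all nx_inj nx_det (stacky_parallel hSigma) nx_conn) => p q t t0.
by rewrite -[X in one_arc _ X](rowE (F p q t)); move/arcP: (hD t t0); apply.
Qed.
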